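(* The category $\mathbf{cbasic}$ of compact basic extensions is equivalent to the category $\mathbf{ubal}$ of uniformly complete bounded archimedean $\ell$-algebras and unital $\ell$-algebra homomorphisms.
   Context: An $\ell$-ring is a ring $A$ with $1$ and a partial order $\le$ making $A$ a lattice, such that $a\le b$ implies $a+c\le b+c$, and $0\le a,b$ implies $0\le ab$. It is bounded if for each $a$ there is $n\in\mathbb N$ with $a\le n\cdot 1$; archimedean if $na\le b$ for all $n\in\mathbb N$ implies $a\le 0$; an $\ell$-algebra if it is an $\mathbb R$-algebra and $0\le a\in A$, $0\le r\in\mathbb R$ imply $0\le ra$. Let $\mathbf{bal}$ be the category of bounded archimedean $\ell$-algebras and unital $\ell$-algebra homomorphisms. Real numbers $r$ are identified with $r\cdot 1$. $A\in\mathbf{bal}$ is uniformly complete if it is complete in the norm $\|a\|=\inf\{r\in\mathbb R: |a|\le r\}$, where $|a|=a\vee(-a)$; $\mathbf{ubal}$ is the full subcategory of $\mathbf{bal}$ of uniformly complete objects. $B\in\mathbf{bal}$ is Dedekind complete if each (nonempty) subset bounded above has a least upper bound. A basic algebra is a Dedekind complete $B\in\mathbf{bal}$ whose boolean algebra of idempotents is atomic. A unital $\ell$-algebra homomorphism between Dedekind complete algebras is normal if it preserves all existing joins (hence all existing meets). A basic extension is a monomorphism $\alpha:A\to B$ in $\mathbf{bal}$, with $B$ a basic algebra, such that each element of $B$ is a join of meets of elements of $\alpha[A]$. The category $\mathbf{basic}$ has basic extensions as objects; a morphism from $\alpha:A\to B$ to $\alpha':A'\to B'$ is a pair $(\rho,\sigma)$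 of morphisms $\rho:A\to A'$, $\sigma:B\to B'$ in $\mathbf{bal}$ with $\sigma$ normal and $\sigma\circ\alpha=\alpha'\circ\rho$; composition is componentwise. A basic extension $\alpha:A\to B$ satisfies (C) if for all $S,T\subseteq A$ and $\varepsilon>0$: if $\bigwedge\alpha[S]+\varepsilon\le\bigvee\alpha[T]$ (the meet and join being presupposed to exist in $B$), then there are finite subsets $S'\subseteq S$ and $T'\subseteq T$ with $\bigwedge S'\le\bigvee T'$. A basic extension $\alpha:A\to B$ is compact if $A\in\mathbf{ubal}$ and $\alpha$ satisfies (C). $\mathbf{cbasic}$ is the full subcategory of $\mathbf{basic}$ consisting of compact basic extensions. *)

(* Defs.v *)
From HB Require Import structures.
From mathcomp Require Import all_boot all_order all_algebra.
From mathcomp Require Import boolp classical_sets functions cardinality reals.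

Set Implicit Arguments.
Unset Strict Implicit.
Unset Printing Implicit Defensive.

Import Order.TTheory GRing.Theory Num.Theory.

Local Open Scope classical_set_scope.
Local Open Scope ring_scope.

(** * Categories *)

Record category := Category {
  ob :> Type;
  hom : ob -> ob -> Type;
  idm : forall x, hom x x;
  comp : forall x y z, hom y z -> hom x y -> hom x z;
  comp_idl : forall x y (f : hom x y), comp (idm y) f = f;
  comp_idr : forall x y (f : hom x y), comp f (idm x) = f;
  compA : forall x y z t (h : hom z t) (g : hom y z) (f : hom x y),
    comp h (comp g f) = comp (comp h g) f
}.

Arguments hom {c}.
Arguments idm {c}.
Arguments comp {c x y z}.

Definition monomorphism (C : category) (x y : C) (f : hom x y) : Prop :=
  forall (z : C) (g h : hom z x), comp f g = comp f h -> g = h.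

Definition isomorphism (C : category) (x y : C) (f : hom x y) : Prop :=
  exists g : hom y x, comp g f = idm x /\ comp f g = idm y.

Definition full_subcategory (C : category) (P : C -> Prop) : category :=
  @Category {x : C | P x}
    (fun x y => hom (sval x) (sval y))
    (fun x => idm (sval x))
    (fun x y z => @comp C (sval x) (sval y) (sval z))
    (fun x y => @comp_idl C (sval x) (sval y))
    (fun x y => @comp_idr C (sval x) (sval y))
    (fun x y z t => @compA C (sval x) (sval y) (sval z) (sval t)).

Record functor (C D : category) := Functor {
  fob :> C -> D;
  fmap : forall x y : C, hom x y -> hom (fob x) (fob y);
  fmap_id : forall x : C, fmap (idm x) = idm (fob x);
  fmap_comp : forall (x y z : C) (g : hom y z) (f : hom x y),
    fmap (comp g f) = comp (fmap g) (fmap f)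
}.

Arguments fmap {C D} F {x y} : rename.

Definition functor_id (C : category) : functor C C :=
  @Functor C C id (fun _ _ f => f) (fun _ => erefl) (fun _ _ _ _ _ => erefl).

Section FunctorComp.
Variables (C D E : category) (G : functor D E) (F : functor C D).

Let map (x y : C) (f : hom x y) : hom (G (F x)) (G (F y)) := fmap G (fmap F f).

Fact functor_comp_id (x : C) : map (idm x) = idm (G (F x)).
Proof. by rewrite /map !fmap_id. Qed.

Fact functor_comp_comp (x y z : C) (g : hom y z) (f : hom x y) :
  map (comp g f) = comp (map g) (map f).
Proof. by rewrite /map !fmap_comp. Qed.

Definition functor_comp : functor C E :=
  Functor functor_comp_id functor_comp_comp.
End FunctorComp.

Definition naturally_isomorphic (C D : category) (F G : functor C D) : Prop :=
  exists eta : forall x : C, hom (F x) (G x),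
    (forall (x y : C) (f : hom x y),
       comp (eta y) (fmap F f) = comp (fmap G f) (eta x)) /\
    (forall x : C, isomorphism (eta x)).

Definition equivalent_categories (C D : category) : Prop :=
  exists (F : functor C D) (G : functor D C),
    naturally_isomorphic (functor_id C) (functor_comp G F) /\
    naturally_isomorphic (functor_comp F G) (functor_id D).

(** * Lattice-ordered algebras *)

(* The scalar multiplication and the order are explicit fields, and the library
   structures [lmodType R] and [latticeType] are derived from them below:
   Hierarchy-Builder rejects a new structure over [GRing.PzRing],
   [GRing.Lmodule] and [Order.Lattice], since [algType] and [realDomainType] do
   not factor through such a join.  [algType R] itself is not used because it
   requires [1 != 0], whereas the zero ring is allowed here. *)
Record lAlgType (R : realType) := LAlgType {
  lalg_ring : pzRingType;
  lalg_scale : R -> lalg_ring -> lalg_ring;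
  lalg_scaleA : forall (r s : R) (a : lalg_ring),
    lalg_scale r (lalg_scale s a) = lalg_scale (r * s) a;
  lalg_scale1 : left_id 1 lalg_scale;
  lalg_scaleDr : right_distributive lalg_scale +%R;
  lalg_scaleDl : forall a : lalg_ring, {morph lalg_scale^~ a : r s / r + s};
  lalg_scaleAl : forall (r : R) (a b : lalg_ring),
    lalg_scale r (a * b) = lalg_scale r a * b;
  lalg_scaleAr : forall (r : R) (a b : lalg_ring),
    lalg_scale r (a * b) = a * lalg_scale r b;
  lalg_le : rel lalg_ring;
  lalg_le_refl : reflexive lalg_le;
  lalg_le_anti : antisymmetric lalg_le;
  lalg_le_trans : transitive lalg_le;
  lalg_meet : lalg_ring -> lalg_ring -> lalg_ring;
  lalg_join : lalg_ring -> lalg_ring -> lalg_ring;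
  lalg_meetP : forall a b c : lalg_ring,
    lalg_le a (lalg_meet b c) = lalg_le a b && lalg_le a c;
  lalg_joinP : forall a b c : lalg_ring,
    lalg_le (lalg_join a b) c = lalg_le a c && lalg_le b c;
  lalg_leD2r : forall c a b : lalg_ring,
    lalg_le a b -> lalg_le (a + c) (b + c);
  lalg_mul_ge0 : forall a b : lalg_ring,
    lalg_le 0 a -> lalg_le 0 b -> lalg_le 0 (a * b);
  lalg_scale_ge0 : forall (r : R) (a : lalg_ring),
    0 <= r -> lalg_le 0 a -> lalg_le 0 (lalg_scale r a)
}.

(* A constant distinct from [GRing.PzRing.sort (lalg_ring A)], to serve as key
   for the canonical instances. *)
Definition lalg_sort (R : realType) (A : lAlgType R) : Type := lalg_ring A.
Coercion lalg_sort : lAlgType >-> Sortclass.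

HB.instance Definition _ (R : realType) (A : lAlgType R) :=
  GRing.PzRing.copy (lalg_sort A) (lalg_ring A).

HB.instance Definition _ (R : realType) (A : lAlgType R) :=
  GRing.Zmodule_isLmodule.Build R (lalg_sort A)
    (@lalg_scaleA R A) (@lalg_scale1 R A) (@lalg_scaleDr R A)
    (@lalg_scaleDl R A).

HB.instance Definition _ (R : realType) (A : lAlgType R) :=
  Order.Le_isPOrder.Build ring_display (lalg_sort A)
    (@lalg_le_refl R A) (@lalg_le_anti R A) (@lalg_le_trans R A).

HB.instance Definition _ (R : realType) (A : lAlgType R) :=
  Order.POrder_MeetJoin_isLattice.Build ring_display (lalg_sort A)
    (@lalg_meetP R A) (@lalg_joinP R A).

Definition lalg_const (R : realType) (A : lAlgType R) (r : R) : A :=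
  r *: (1 : A).

Definition lalg_bounded (R : realType) (A : lAlgType R) : Prop :=
  forall a : A, exists n : nat, a <= n%:R.

Definition lalg_archimedean (R : realType) (A : lAlgType R) : Prop :=
  forall a b : A, (forall n : nat, a *+ n <= b) -> a <= 0.

Record balType (R : realType) := BalType {
  bal_alg :> lAlgType R;
  bal_bounded : lalg_bounded bal_alg;
  bal_archimedean : lalg_archimedean bal_alg
}.

(** * The categories bal and ubal *)

Definition is_lalg_hom (R : realType) (A B : lAlgType R) (f : A -> B) : Prop :=
  [/\ f 1 = 1,
      {morph f : a b / a + b},
      {morph f : a b / a * b},
      (forall (r : R) (a : A), f (r *: a) = r *: f a) &
      {morph f : a b / Order.meet a b} /\ {morph f : a b / Order.join a b}].

Record lalg_hom (R : realType) (A B : lAlgType R) := LAlgHom {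
  lalg_fun :> A -> B;
  lalg_homP : is_lalg_hom lalg_fun
}.

Lemma lalg_hom_eq (R : realType) (A B : lAlgType R) (f g : lalg_hom A B) :
  (f : A -> B) = g -> f = g.
Proof.
case: f g => [f fP] [g gP] /= fg; case: _ / fg in gP *.
by rewrite (Prop_irrelevance fP gP).
Qed.

Fact is_lalg_hom_id (R : realType) (A : lAlgType R) : is_lalg_hom (@id A).
Proof. by []. Qed.

Fact is_lalg_hom_comp (R : realType) (A B C : lAlgType R)
  (g : lalg_hom B C) (f : lalg_hom A B) : is_lalg_hom (g \o f).
Proof.
have [f1 fD fM fZ [fI fU]] := lalg_homP f.
have [g1 gD gM gZ [gI gU]] := lalg_homP g.
split; [|move=> x y|move=> x y|move=> r x|split=> x y] => /=.
- by rewrite f1.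
- by rewrite fD.
- by rewrite fM.
- by rewrite fZ.
- by rewrite fI.
- by rewrite fU.
Qed.

Definition lalg_hom_id (R : realType) (A : lAlgType R) : lalg_hom A A :=
  LAlgHom (is_lalg_hom_id A).

Definition lalg_hom_comp (R : realType) (A B C : lAlgType R)
  (g : lalg_hom B C) (f : lalg_hom A B) : lalg_hom A C :=
  LAlgHom (is_lalg_hom_comp g f).

Definition bal (R : realType) : category.
Proof.
apply: (@Category (balType R) (fun A B => lalg_hom A B)
  (fun A => lalg_hom_id A) (fun A B C g f => lalg_hom_comp g f)) => *;
  exact: lalg_hom_eq.
Defined.

Definition labs (R : realType) (A : lAlgType R) (a : A) : A := Order.join a (- a).

(* In the zero algebra the set below is all of [R], and [inf] is then [0]. *)
Definition unorm (R : realType) (A : lAlgType R) (a : A) : R :=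
  inf [set r : R | labs a <= lalg_const A r].

Definition uniformly_complete (R : realType) (A : lAlgType R) : Prop :=
  forall u : nat -> A,
    (forall e : R, 0 < e -> exists N : nat, forall m n : nat,
       (N <= m)%N -> (N <= n)%N -> unorm (u m - u n) < e) ->
    exists l : A, forall e : R, 0 < e -> exists N : nat, forall n : nat,
       (N <= n)%N -> unorm (u n - l) < e.

Definition ubal (R : realType) : category :=
  full_subcategory (fun A : bal R => uniformly_complete (A : balType R)).

(** * Basic algebras and basic extensions *)

(* [supremums S b] and [infimums S b] read: the join, resp. meet, of [S] exists
   and is equal to [b]. *)

Definition dedekind_complete (R : realType) (A : lAlgType R) : Prop :=
  forall S : set A, S !=set0 -> has_ubound S -> exists b, supremums S b.

Definition is_idempotent (R : realType) (A : lAlgType R) (e : A) : Prop := e * e = e.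

(* The order of the boolean algebra of idempotents: the meet of [e] and [f] is
   [e * f]. *)
Definition idem_le (R : realType) (A : lAlgType R) (e f : A) : Prop := e * f = e.

Definition idem_atom (R : realType) (A : lAlgType R) (a : A) : Prop :=
  [/\ is_idempotent a, a <> 0 &
      forall e : A, is_idempotent e -> idem_le e a -> e = 0 \/ e = a].

Definition idempotents_atomic (R : realType) (A : lAlgType R) : Prop :=
  forall e : A, is_idempotent e -> e <> 0 ->
    exists2 a : A, idem_atom a & idem_le a e.

Definition basic_algebra (R : realType) (B : balType R) : Prop :=
  dedekind_complete B /\ idempotents_atomic B.

Definition normal_hom (R : realType) (A B : lAlgType R) (f : lalg_hom A B) : Prop :=
  forall (S : set A) (a : A), supremums S a -> supremums (f @` S) (f a).

Definition join_meet_dense (R : realType) (A B : lAlgType R) (f : lalg_hom A B) : Prop :=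
  forall b : B, exists2 M : set B,
    (forall m : B, M m -> exists S : set A, infimums (f @` S) m) &
    supremums M b.

Record basic_extension (R : realType) := BasicExtension {
  bext_dom : balType R;
  bext_cod : balType R;
  bext_map : lalg_hom bext_dom bext_cod;
  bext_cod_basic : basic_algebra bext_cod;
  bext_mono : @monomorphism (bal R) bext_dom bext_cod bext_map;
  bext_dense : join_meet_dense bext_map
}.

Record basic_hom (R : realType) (X Y : basic_extension R) := BasicHom {
  bhom_dom : lalg_hom (bext_dom X) (bext_dom Y);
  bhom_cod : lalg_hom (bext_cod X) (bext_cod Y);
  bhom_normal : normal_hom bhom_cod;
  bhom_comm : lalg_hom_comp bhom_cod (bext_map X) =
              lalg_hom_comp (bext_map Y) bhom_dom
}.

Lemma basic_hom_eq (R : realType) (X Y : basic_extension R) (f g : basic_hom X Y) :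
  bhom_dom f = bhom_dom g -> bhom_cod f = bhom_cod g -> f = g.
Proof.
case: f g => [f1 f2 fN fC] [g1 g2 gN gC] /= e1 e2.
case: _ / e1 in gC *; case: _ / e2 in gN gC *.
by rewrite (Prop_irrelevance fN gN) (Prop_irrelevance fC gC).
Qed.

Fact normal_hom_id (R : realType) (A : lAlgType R) : normal_hom (lalg_hom_id A).
Proof. by move=> S a; rewrite image_id. Qed.

Fact normal_hom_comp (R : realType) (A B C : lAlgType R)
    (g : lalg_hom B C) (f : lalg_hom A B) :
  normal_hom g -> normal_hom f -> normal_hom (lalg_hom_comp g f).
Proof. by move=> gN fN S a /fN /gN; rewrite image_comp. Qed.

Definition basic_hom_id (R : realType) (X : basic_extension R) : basic_hom X X :=
  @BasicHom R X X (lalg_hom_id _) (lalg_hom_id _) (@normal_hom_id R _)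
    (@lalg_hom_eq R _ _ (lalg_hom_comp (lalg_hom_id _) (bext_map X))
       (lalg_hom_comp (bext_map X) (lalg_hom_id _)) erefl).

Section BasicHomComp.
Variables (R : realType) (X Y Z : basic_extension R).
Variables (g : basic_hom Y Z) (f : basic_hom X Y).

Fact basic_hom_comp_comm :
  lalg_hom_comp (lalg_hom_comp (bhom_cod g) (bhom_cod f)) (bext_map X) =
  lalg_hom_comp (bext_map Z) (lalg_hom_comp (bhom_dom g) (bhom_dom f)).
Proof.
apply: lalg_hom_eq; apply: funext => a /=.
have /(congr1 (fun h : lalg_hom _ _ => h a)) /= -> := bhom_comm f.
by have /(congr1 (fun h : lalg_hom _ _ => h (bhom_dom f a))) := bhom_comm g.
Qed.

Definition basic_hom_comp : basic_hom X Z :=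
  BasicHom (normal_hom_comp (@bhom_normal R Y Z g) (@bhom_normal R X Y f))
    basic_hom_comp_comm.
End BasicHomComp.

Definition basic (R : realType) : category.
Proof.
apply: (@Category (basic_extension R) (@basic_hom R) (@basic_hom_id R)
  (@basic_hom_comp R)) => *; apply: basic_hom_eq; exact: lalg_hom_eq.
Defined.

(** * Compact basic extensions *)

(* [S'] and [T'] may be empty only when the corresponding meet or join exists,
   that is, only when [A] is the zero algebra. *)
Definition condition_C (R : realType) (A B : lAlgType R) (f : lalg_hom A B) : Prop :=
  forall (S T : set A) (e : R) (m j : B), 0 < e ->
    infimums (f @` S) m -> supremums (f @` T) j -> m + lalg_const B e <= j ->
    exists (S' T' : set A) (a b : A),
      [/\ finite_set S' /\ S' `<=` S, finite_set T' /\ T' `<=` T,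
          infimums S' a, supremums T' b & a <= b].

Definition compact_extension (R : realType) (X : basic_extension R) : Prop :=
  uniformly_complete (bext_dom X) /\ condition_C (bext_map X).

Definition cbasic (R : realType) : category :=
  full_subcategory (fun X : basic R => compact_extension (X : basic_extension R)).

(* Main.v *)
(* A compact basic extension [f : A -> B] is determined by [A]: it is isomorphic
   to the embedding of [A] into the algebra of bounded functions on the set of
   points of [A], i.e. of unital l-algebra homomorphisms [A -> R].
   If every point is positive at some element of a subset [X] of [A], then
   finitely many elements of [X] have positive parts summing to at least [1]
   (Zorn's lemma); this yields both condition (C) for the evaluation embedding
   and the Yosida representation.
   Conversely, given [f], a point [y] has the "atom"
   [e y = meet {f a | 0 <= a, 1 <= y a}], which is nonzero by (C).  The elements
   [b] with [b * e y = r e y] for some real [r] include [f A] and are closed under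
   existing joins and meets, hence are all of [B], and [b |-> r] extends [y] to
   [B].  These extensions identify [B] with the bounded functions on the points
   of [A].  Naturality is automatic: a normal homomorphism on [B] is determined
   by its restriction to [A]. *)
From HB Require Import structures.
From mathcomp Require Import all_boot all_order all_algebra.
From mathcomp Require Import boolp classical_sets cardinality.
From mathcomp Require Import lra.
Require Import Defs.
From mathcomp Require Import reals.

Set Implicit Arguments.
Unset Strict Implicit.
Unset Printing Implicit Defensive.

Import Order.TTheory GRing.Theory Num.Theory.

Local Open Scope classical_set_scope.
Local Open Scope ring_scope.

(** * Lattice-ordered algebras *)

Section LAlgTheory.
Variables (R : realType) (A : lAlgType R).
Implicit Types (a b c d p q x z : A) (r s : R).

Lemma lalg_lerD2r c a b : (a + c <= b + c) = (a <= b).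
Proof.
have D c' a' b' : a' <= b' :> A -> a' + c' <= b' + c' by exact: lalg_leD2r.
by apply/idP/idP => [/(D (- c))|/D//]; rewrite !addrK.
Qed.

Lemma lalg_lerD2l c a b : (c + a <= c + b) = (a <= b).
Proof. by rewrite ![c + _]addrC lalg_lerD2r. Qed.

Lemma lalg_lerD a b c d : a <= b -> c <= d -> a + c <= b + d.
Proof.
by move=> ab cd; rewrite (@le_trans _ _ (b + c)) ?lalg_lerD2r ?lalg_lerD2l.
Qed.

Lemma lalg_subr_ge0 a b : (0 <= b - a) = (a <= b).
Proof. by rewrite -[LHS](lalg_lerD2r a) add0r subrK. Qed.

Lemma lalg_subr_le0 a b : (a - b <= 0) = (a <= b).
Proof. by rewrite -[LHS](lalg_lerD2r b) add0r subrK. Qed.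

Lemma lalg_lerN2 a b : (- a <= - b) = (b <= a).
Proof. by rewrite -[LHS]lalg_subr_ge0 opprK addrC lalg_subr_ge0. Qed.

Lemma lalg_addr_ge0 a b : 0 <= a -> 0 <= b -> 0 <= a + b.
Proof. by move=> a0 b0; rewrite -[0]addr0 lalg_lerD. Qed.

Lemma lalg_lerDl_ge0 a b : 0 <= b -> a <= a + b.
Proof. by move=> b0; rewrite -{1}[a]addr0 lalg_lerD2l. Qed.

Lemma lalg_mulr_ge0 a b : 0 <= a -> 0 <= b -> 0 <= a * b.
Proof. exact: lalg_mul_ge0. Qed.

Lemma lalg_scaler_ge0 r a : 0 <= r -> 0 <= a -> 0 <= r *: a.
Proof. exact: lalg_scale_ge0. Qed.

Lemma lalg_ler_wpZ2l r a b : 0 <= r -> a <= b -> r *: a <= r *: b.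
Proof.
by move=> r0 ab; rewrite -lalg_subr_ge0 -scalerBr lalg_scaler_ge0 // lalg_subr_ge0.
Qed.

Lemma lalg_ler_wpZ2r r s a : 0 <= a -> r <= s -> r *: a <= s *: a.
Proof.
by move=> a0 rs; rewrite -lalg_subr_ge0 -scalerBl lalg_scaler_ge0 // subr_ge0.
Qed.

Lemma lalg_ler_wpM2l c a b : 0 <= c -> a <= b -> c * a <= c * b.
Proof.
by move=> c0 ab; rewrite -lalg_subr_ge0 -mulrBr lalg_mulr_ge0 // lalg_subr_ge0.
Qed.

Lemma lalg_ler_wpM2r c a b : 0 <= c -> a <= b -> a * c <= b * c.
Proof.
by move=> c0 ab; rewrite -lalg_subr_ge0 -mulrBl lalg_mulr_ge0 // lalg_subr_ge0.
Qed.

Lemma lalg_scalerAl r a b : (r *: a) * b = r *: (a * b).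
Proof. by symmetry; exact: lalg_scaleAl. Qed.

Lemma lalg_scalerAr r a b : a * (r *: b) = r *: (a * b).
Proof. by symmetry; exact: lalg_scaleAr. Qed.

Lemma lalg_addrUl a b c : Order.join a b + c = Order.join (a + c) (b + c).
Proof.
apply/le_anti/andP; split; last by rewrite leUx !lalg_lerD2r leUl leUr.
rewrite -(lalg_lerD2r (- c)) addrK leUx -(lalg_lerD2r c a) -(lalg_lerD2r c b).
by rewrite !subrK leUl leUr.
Qed.

Lemma lalg_addrIl a b c : Order.meet a b + c = Order.meet (a + c) (b + c).
Proof.
apply/le_anti/andP; split; first by rewrite lexI !lalg_lerD2r leIl leIr.
rewrite -(lalg_lerD2r (- c)) addrK lexI -(lalg_lerD2r c _ a) -(lalg_lerD2r c _ b).
by rewrite !subrK leIl leIr.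
Qed.

Lemma lalg_meet_join a b : Order.meet a b = a + b - Order.join a b.
Proof.
apply/le_anti/andP; split.
  rewrite -(lalg_lerD2r (Order.join a b)) subrK addrC lalg_addrUl.
  by rewrite leUx lalg_lerD2l leIr addrC lalg_lerD2r leIl.
rewrite lexI -(lalg_lerD2r (Order.join a b) _ a) -(lalg_lerD2r (Order.join a b) _ b).
rewrite !subrK lalg_lerD2l leUr/=.
by rewrite addrC lalg_lerD2l leUl.
Qed.

(** The positive part [a^+]; the negative part [a^-] is written [lalg_pos (- a)]. *)
Definition lalg_pos a : A := Order.join a 0.

Lemma lalg_pos_ge0 a : 0 <= lalg_pos a. Proof. exact: leUr. Qed.

Lemma lalg_le_pos a : a <= lalg_pos a. Proof. exact: leUl. Qed.

Lemma lalg_pos_le a b : (lalg_pos a <= b) = (a <= b) && (0 <= b).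
Proof. exact: leUx. Qed.

Lemma lalg_posB a : lalg_pos a - lalg_pos (- a) = a.
Proof.
have -> : lalg_pos a = lalg_pos (- a) + a.
  by rewrite /lalg_pos lalg_addrUl addNr add0r joinC.
by rewrite addrAC subrr add0r.
Qed.

(** Translating by [a^-] in [a^+ = a + a^-] turns the meet into [(a /\ 0) + a^-], and
    [a /\ 0 = a - a^+ = - a^-]. *)
Lemma lalg_meet_posN a : Order.meet (lalg_pos a) (lalg_pos (- a)) = 0.
Proof.
have e : lalg_pos a = a + lalg_pos (- a) by apply/eqP; rewrite -subr_eq lalg_posB.
rewrite {1}e -{2}[lalg_pos (- a)]add0r -lalg_addrIl lalg_meet_join addr0.
by rewrite -/(lalg_pos a) e opprD addrA subrr add0r addNr.
Qed.

(** Translations distribute over meets, so the right-hand side is the meet of [x + x], [x + b],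
    [a + x] and [a + b]; the first three lie above [x]. *)
Lemma lalg_meetD_le x a b : 0 <= x -> 0 <= a -> 0 <= b ->
  Order.meet x (a + b) <= Order.meet x a + Order.meet x b.
Proof.
move=> x0 a0 b0; rewrite lalg_addrIl lexI [x + _]addrC [a + Order.meet _ _]addrC.
rewrite !lalg_addrIl !lexI [x + a]addrC [b + x]addrC [b + a]addrC leIr andbT -andbA.
apply/and3P; split; rewrite (le_trans (leIl _ _)) ?lalg_lerDl_ge0//.
by rewrite addrC lalg_lerDl_ge0.
Qed.

Lemma lalg_mulrn_ge0 a n : 0 <= a -> 0 <= a *+ n.
Proof.
by move=> a0; elim: n => [|n ih]; rewrite ?mulr0n ?mulrS ?lalg_addr_ge0.
Qed.

Lemma lalg_lerMn2r a b n : a <= b -> a *+ n <= b *+ n.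
Proof.
by move=> ab; elim: n => [|n ih]; rewrite ?mulr0n ?mulrS ?lalg_lerD.
Qed.

Lemma lalg_meetMn_le x a n : 0 <= x -> 0 <= a ->
  Order.meet x (a *+ n) <= Order.meet x a *+ n.
Proof.
move=> x0 a0; elim: n => [|n ih]; first by rewrite !mulr0n leIr.
rewrite !mulrS (le_trans (lalg_meetD_le _ _ _))// ?lalg_mulrn_ge0//.
by rewrite lalg_lerD2l.
Qed.

(** Boundedness and disjointness combine: [q] is below [q /\ m 1^+], hence below
    [m (q /\ (a + n p))], hence below [m (q /\ a + n (q /\ p)) = m (q /\ a)]. This drives both the
    totality of maximal cones and the Yosida representation. *)
Lemma lalg_disjoint_le p q a (m n : nat) : 0 <= p -> 0 <= q -> 0 <= a ->
  Order.meet p q = 0 -> q <= m%:R -> (1 : A) <= a + p *+ n -> q <= a *+ m.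
Proof.
move=> p0 q0 a0 pq qm h1.
(* The positive part of [1] replaces [1], since [0 <= 1] is obtained only later, from
   boundedness. *)
have h01 : 0 <= lalg_pos (1 : A) by exact: lalg_pos_ge0.
have qp : q <= Order.meet q (lalg_pos 1 *+ m).
  by rewrite lexI lexx (le_trans qm) ?lalg_lerMn2r ?lalg_le_pos.
apply: (le_trans qp); apply: (le_trans (lalg_meetMn_le _ q0 h01)).
apply: lalg_lerMn2r.
have h2 : lalg_pos 1 <= a + p *+ n.
  by rewrite lalg_pos_le h1 lalg_addr_ge0// lalg_mulrn_ge0.
apply: (le_trans (leI2 (lexx q) h2)).
apply: (le_trans (lalg_meetD_le _ _ _)) => //; first exact: lalg_mulrn_ge0.
rewrite -[leRHS]addr0 lalg_lerD ?leIr//.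
apply: (le_trans (lalg_meetMn_le _ _ _)) => //.
by rewrite meetC pq mul0rn.
Qed.

End LAlgTheory.

(** * Existence of points *)

(** Values are taken in [R] itself, with its own maximum, rather than in an [lAlgType]; preservation
    of meets is derived in [pointI]. *)
Record point (R : realType) (A : lAlgType R) := Point {
  point_fun :> A -> R;
  point1 : point_fun 1 = 1;
  pointD : {morph point_fun : a b / a + b};
  pointM : {morph point_fun : a b / a * b};
  pointZ : forall r a, point_fun (r *: a) = r * point_fun a;
  pointU : {morph point_fun : a b / Order.join a b >-> Num.max a b}
}.

(** * From a maximal proper cone to a point *)

Section PointOfCone.
Variables (R : realType) (A : balType R).
Implicit Types (a b x : A) (r s e : R).

Lemma bal_le_nat r : exists n : nat, r <= n%:R.
Proof.
case: (leP 0 r) => [/archi_boundP/ltW|/ltW r0]; first by eexists; eauto.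
by exists 0%N.
Qed.

(** Boundedness gives [n] with [- 1 <= n], so that [n + 1] copies of [1] are nonnegative; divide by
    [n + 1]. *)
Lemma bal_le01 : 0 <= 1 :> A.
Proof.
have [n n1] := bal_bounded (- 1 : A).
have h : 0 <= n.+1%:R *: (1 : A).
  by rewrite scaler_nat mulrSr -(lalg_lerD2r (- 1)) add0r addrK.
have := lalg_scaler_ge0 (_ : 0 <= n.+1%:R^-1) h.
by rewrite scalerA mulVf ?scale1r ?pnatr_eq0// => -> //; rewrite invr_ge0 ler0n.
Qed.

Lemma bal_const_le r s : r <= s -> r *: (1 : A) <= s *: (1 : A).
Proof. exact/lalg_ler_wpZ2r/bal_le01. Qed.

(** [N] collects the elements that are to be nonpositive at the point. [Nmax] is maximality in
    usable form: if [b] cannot be added to [N], then [1] lies below an element of [N] plus a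
    multiple of [b^+]. *)
Variable N : set A.
Hypothesis N0 : N 0.
Hypothesis Nle : forall a b, a <= b -> N b -> N a.
Hypothesis ND : forall a b, N a -> N b -> N (a + b).
Hypothesis Npos : forall a, N a -> N (lalg_pos a).
Hypothesis N1 : ~ N 1.
Hypothesis Nmax : forall b, ~ N b -> exists n, N (1 - lalg_pos b *+ n).

Let NMn a n : N a -> N (a *+ n).
Proof. by move=> Na; elim: n => [|n ih]; rewrite ?mulr0n ?mulrS //; exact: ND. Qed.

Let NZ r a : 0 <= r -> N a -> N (r *: a).
Proof.
move=> r0 Na; have [n rn] := bal_le_nat r.
apply: (@Nle _ (lalg_pos a *+ n)); last exact/NMn/Npos.
apply: (@le_trans _ _ (r *: lalg_pos a)).
  exact/lalg_ler_wpZ2l/lalg_le_pos.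
by rewrite -scaler_nat lalg_ler_wpZ2r// lalg_pos_ge0.
Qed.

Let NU a b : N a -> N b -> N (Order.join a b).
Proof.
move=> /Npos Na /Npos Nb; apply: (Nle _ (ND Na Nb)).
rewrite leUx (le_trans (lalg_le_pos a)) ?lalg_lerDl_ge0 ?lalg_pos_ge0//=.
by rewrite addrC (le_trans (lalg_le_pos b)) ?lalg_lerDl_ge0 ?lalg_pos_ge0.
Qed.

Let Nconst r : N (r *: (1 : A)) -> r <= 0.
Proof.
move=> Nr; rewrite leNgt; apply/negP => r0; apply: N1.
have /(_ r^-1) := NZ _ Nr; rewrite scalerA mulVf ?gt_eqF// scale1r; apply.
by rewrite invr_ge0 ltW.
Qed.

(* If [b] is not in the cone then [1 <= i + n b^+] with [i] in the cone, and
   [b^-] is disjoint from [b^+], hence below a multiple of [i]. *)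
Let Ntotal b : N b \/ N (- b).
Proof.
have [Nb|/Nmax[n Nn]] := pselect (N b); [by left|right].
have [m bm] := bal_bounded (lalg_pos (- b)).
apply: (Nle (lalg_le_pos _)).
apply: (@Nle _ (lalg_pos (1 - lalg_pos b *+ n) *+ m)); last exact/NMn/Npos.
apply: (@lalg_disjoint_le _ _ (lalg_pos b) _ _ _ n) => //;
  rewrite ?lalg_pos_ge0 ?lalg_meet_posN//.
by rewrite -(lalg_lerD2r (- (lalg_pos b *+ n))) addrK lalg_le_pos.
Qed.

(** [N] is closed under uniform limits. If [x] were outside [N], some [1 - n x^+] would be in [N].
    Adding [n (x - e)^+], which is at least [n x^+ - n e], puts the constant [1 - n e] in [N]; the
    choice of [e] makes it positive. *)
Let Nclosed x : (forall e, 0 < e -> N (x - e *: (1 : A))) -> N x.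
Proof.
move=> Nx; apply: contrapT => /Nmax[n Nn].
pose e := (n.+1.*2)%:R^-1 : R.
have e0 : 0 < e by rewrite invr_gt0 ltr0n.
have h : N ((1 - e *+ n) *: (1 : A)).
  apply: Nle (ND Nn (NMn n (Npos (Nx _ e0)))).
  set P := lalg_pos x; set Q := lalg_pos _.
  have PQ : P *+ n <= Q *+ n + (e *+ n) *: (1 : A).
    rewrite -scalerMnl -mulrnDl; apply: lalg_lerMn2r; rewrite lalg_pos_le.
    apply/andP; split.
      by rewrite -(lalg_lerD2r (- (e *: (1 : A)))) addrK lalg_le_pos.
    by rewrite lalg_addr_ge0 ?lalg_pos_ge0 ?lalg_scaler_ge0 ?bal_le01 ?ltW.
  rewrite scalerBl scale1r -addrA lalg_lerD2l -(lalg_lerD2l (P *+ n)) addNKr.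
  by rewrite -(lalg_lerD2r ((e *+ n) *: (1 : A))) subrK.
have := Nconst h; rewrite leNgt => /negP; apply.
rewrite subr_gt0 -mulr_natl ltr_pdivrMr ?ltr0n// mul1r ltr_nat.
by rewrite -addnn ltn_addl.
Qed.

(** The kernel of the point under construction: the next facts show that it is a two-sided ideal
    meeting the constants only in [0], with quotient [R]. *)
Let Z x := N x /\ N (- x).

Let ZD a b : Z a -> Z b -> Z (a + b).
Proof. by move=> [a1 a2] [b1 b2]; split; rewrite ?opprD; exact: ND. Qed.

Let ZN a : Z a -> Z (- a).
Proof. by move=> [a1 a2]; split; rewrite ?opprK. Qed.

Let ZZ r a : Z a -> Z (r *: a).
Proof.
wlog r0 : r a / 0 <= r => [h Za|[a1 a2]].
  have [/h|/ltW r0] := leP 0 r; first exact.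
  have -> : r *: a = (- r) *: (- a) by rewrite scalerN scaleNr opprK.
  by apply: h; [rewrite oppr_ge0|exact: ZN].
by split; rewrite -?scalerN; exact: NZ.
Qed.

Let NMpos a b : N a -> N (lalg_pos a * lalg_pos b) /\ N (lalg_pos b * lalg_pos a).
Proof.
move=> Na; have [n bn] := bal_bounded (lalg_pos b).
have Nn : N (lalg_pos a *+ n) by exact/NMn/Npos.
by split; apply: Nle Nn; rewrite -[leRHS]mulr_natl; [rewrite mulr_natl -mulr_natr|];
  [apply: lalg_ler_wpM2l|apply: lalg_ler_wpM2r]; rewrite ?lalg_pos_ge0.
Qed.

(** Boundedness puts the products of positive and negative parts in [N]. Expanding the product of
    the two differences bounds it, and its opposite, by a sum of two such products. Both orders are
    treated because [A] need not be commutative. *)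
Let ZM a b : Z a -> Z (a * b) /\ Z (b * a).
Proof.
move=> [a1 a2].
have [pp pp'] := NMpos b a1; have [pn pn'] := NMpos (- b) a1.
have [np np'] := NMpos b a2; have [nn nn'] := NMpos (- b) a2.
have sub_le (p q : A) : 0 <= q -> p - q <= p :> A.
  by move=> q0; rewrite -(lalg_lerD2r q) subrK lalg_lerDl_ge0.
have h (u v u' v' : A) : 0 <= u -> 0 <= v -> 0 <= u' -> 0 <= v' ->
    N (u * u') -> N (v * v') -> N (u * v') -> N (v * u') -> Z ((u - v) * (u' - v')).
  move=> u0 v0 u0' v0' h1 h2 h3 h4.
  have -> : (u - v) * (u' - v') = (u * u' + v * v') - (u * v' + v * u').
    by rewrite mulrBl !mulrBr !opprB opprD addrACA.
  split; rewrite ?opprB.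
    by apply: Nle (ND h1 h2); rewrite sub_le// lalg_addr_ge0// lalg_mulr_ge0.
  by apply: Nle (ND h3 h4); rewrite sub_le// lalg_addr_ge0// lalg_mulr_ge0.
split; rewrite -(lalg_posB a) -(lalg_posB b); apply: h => //; exact: lalg_pos_ge0.
Qed.

Let Zconst r : Z (r *: (1 : A)) -> r = 0.
Proof.
move=> [/Nconst r1]; rewrite -scaleNr => /Nconst; rewrite oppr_le0 => r2.
by apply/le_anti; rewrite r1 r2.
Qed.

(** The value of [a] is the infimum of the [r] with [a - r] in [N]. Below the infimum [a - r] leaves
    [N], so by totality [r - a] enters it; closedness then reaches the infimum from both sides. *)
Let Zex a : exists r, Z (a - r *: (1 : A)).
Proof.
pose E := [set r | N (a - r *: (1 : A))].
have [n an] := bal_bounded a; have [m am] := bal_bounded (- a).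
have En : E n%:R.
  by apply: Nle N0; rewrite lalg_subr_le0 scaler_nat.
have Em : lbound E (- m%:R).
  move=> r Er; rewrite -subr_le0; apply: Nconst; apply: Nle Er.
  by rewrite scalerBl lalg_lerD2r scaleNr scaler_nat -lalg_lerN2 opprK.
have hE : has_inf E by split; [exists n%:R|exists (- m%:R)].
exists (inf E); split.
  apply: Nclosed => e e0; have [r Er re] := inf_adherent e0 hE.
  apply: Nle Er; rewrite -addrA lalg_lerD2l -opprD lalg_lerN2 -scalerDl.
  exact/bal_const_le/ltW.
apply: Nclosed => e e0.
have [Ne|] := Ntotal (a - (inf E - e) *: (1 : A)).
  have : inf E <= inf E - e by apply: ge_inf => //; exists (- m%:R).
  by lra.
by rewrite !opprB scalerBl addrAC.
Qed.

Lemma point_of_maximal_cone : exists y : point A, forall x, N x -> y x <= 0.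
Proof.
have /choice[y yP] := Zex.
(* The value is unique modulo [Z], so each operation is checked by a congruence modulo the ideal
   [Z]. *)
have yE a r : Z (a - r *: (1 : A)) -> y a = r.
  move=> h; have := ZD (yP a) (ZN h).
  by rewrite opprB addrC subrKA -scalerBl => /Zconst/subr0_eq.
have y_le a b : N (a - b) -> y a <= y b.
  move=> ab; have [_ a2] := yP a; have [b1 _] := yP b.
  have := ND a2 (ND ab b1).
  by rewrite opprB !subrKA -scalerBl => /Nconst; rewrite subr_le0.
have Z0 : Z 0 by split; rewrite ?oppr0.
have y_le_const a r : N (a - r *: (1 : A)) -> y a <= r.
  by move=> /y_le; rewrite (yE (r *: (1 : A)) r)// subrr.
have y1 : y 1 = 1 by apply: yE; rewrite scale1r subrr.
have yD : {morph y : a b / a + b}.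
  by move=> a b; apply: yE; rewrite scalerDl opprD addrACA; exact: ZD.
have yM : {morph y : a b / a * b}.
  move=> a b; apply: yE.
  have -> : a * b - (y a * y b) *: (1 : A) =
      (a - y a *: (1 : A)) * b + y a *: (b - y b *: (1 : A)).
    by rewrite mulrBl lalg_scalerAl mul1r scalerBr scalerA subrKA.
  by apply: ZD; [have [] := ZM b (yP a)|exact: ZZ].
have yZ r a : y (r *: a) = r * y a.
  by apply: yE; rewrite -scalerA -scalerBr; exact: ZZ.
have yU : {morph y : a b / Order.join a b >-> Num.max a b}.
  move=> a b; apply/le_anti/andP; split.
    apply: y_le_const; rewrite lalg_addrUl; apply: NU.
      apply: (Nle _ (yP a).1); rewrite lalg_lerD2l lalg_lerN2.
      by apply: bal_const_le; rewrite le_max lexx.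
    apply: (Nle _ (yP b).1); rewrite lalg_lerD2l lalg_lerN2.
    by apply: bal_const_le; rewrite le_max lexx orbT.
  by rewrite ge_max; apply/andP; split; apply/y_le/(Nle _ N0);
    rewrite lalg_subr_le0 ?leUl ?leUr.
exists (Point y1 yD yM yZ yU) => x Nx /=.
by apply: y_le_const; rewrite scale0r subr0.
Qed.

End PointOfCone.

(** * Elementary properties of points *)

Section PointTheory.
Variables (R : realType) (A : lAlgType R) (y : point A).
Implicit Types (a b : A) (r : R).

Lemma point_const r : y (r *: (1 : A)) = r.
Proof. by rewrite pointZ point1 mulr1. Qed.

Lemma point0 : y 0 = 0.
Proof. by rewrite -(scale0r (1 : A)) point_const. Qed.

Lemma pointN a : y (- a) = - y a.
Proof. by rewrite -scaleN1r pointZ mulN1r. Qed.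

Lemma pointB a b : y (a - b) = y a - y b.
Proof. by rewrite pointD pointN. Qed.

Lemma point_pos a : y (lalg_pos a) = Num.max (y a) 0.
Proof. by rewrite pointU point0. Qed.

Lemma pointI a b : y (Order.meet a b) = Num.min (y a) (y b).
Proof.
rewrite lalg_meet_join pointB pointD pointU.
by apply/eqP; rewrite subr_eq addr_min_max.
Qed.

Lemma point_le a b : a <= b -> y a <= y b.
Proof. by move=> /join_r ab; rewrite -ab pointU le_max lexx. Qed.

Lemma pointMn a n : y (a *+ n) = y a *+ n.
Proof. by elim: n => [|n ih]; rewrite ?mulr0n ?point0// !mulrS pointD ih. Qed.

Lemma point_sum (I : Type) (s : seq I) (f : I -> A) :
  y (\sum_(i <- s) f i) = \sum_(i <- s) y (f i).
Proof. exact: (big_morph y (pointD y) point0). Qed.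

End PointTheory.

Lemma point_eq (R : realType) (A : lAlgType R) (y z : point A) :
  (forall a, y a = z a) -> y = z.
Proof.
case: y z => [y y1 yD yM yZ yU] [z z1 zD zM zZ zU] /= /funext yz.
case: _ / yz in z1 zD zM zZ zU *.
by congr Point; exact: Prop_irrelevance.
Qed.

(** * Zorn's lemma, compactness and the Yosida representation *)

Section PointExistence.
Variables (R : realType) (A : balType R).
Implicit Types (a b x : A) (X : set A) (s : seq A).

Lemma lalg_sum_pos_ge0 s : 0 <= \sum_(x <- s) lalg_pos x.
Proof.
by elim/big_rec: _ => [//|x a _ a0]; rewrite lalg_addr_ge0 ?lalg_pos_ge0.
Qed.

(** The cone generated by the positive parts of [X] is proper. Sequences may repeat entries, which
    accounts for integer multiples. *)
Let consistent X := forall s, (forall x, x \in s -> X x) ->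
  ~ (1 : A) <= \sum_(x <- s) lalg_pos x.

(** A finite sequence meets only finitely many members of the chain, hence fits in the largest of
    them. The first alternative also covers an empty chain. *)
Let chain_seq (F : set (set A)) X s : total_on F subset ->
  (forall x, x \in s -> (X `|` \bigcup_(Y in F) Y) x) ->
  (forall x, x \in s -> X x) \/
  exists2 Y, F Y & forall x, x \in s -> (X `|` Y) x.
Proof.
move=> totF; elim: s => [|a s ih] sF; first by left.
have aF := sF a (mem_head _ _).
have {ih}[x xs|sX|[Y FY sY]] := ih; first by apply: sF; rewrite inE xs orbT.
  case: aF => [Xa|[Z FZ Za]].
    by left => x; rewrite inE => /orP[/eqP->|/sX].
  by right; exists Z => // x; rewrite inE => /orP[/eqP->|/sX]; [right|left].
right; case: aF => [Xa|[Z FZ Za]].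
  by exists Y => // x; rewrite inE => /orP[/eqP->|/sY//]; left.
have [YZ|ZY] := totF _ _ FY FZ.
  exists Z => // x; rewrite inE => /orP[/eqP->|/sY[]]; first by right.
    by left.
  by move=> /YZ; right.
by exists Y => // x; rewrite inE => /orP[/eqP->|/sY//]; right; exact: ZY.
Qed.

Let sum_pos_filter b s : \sum_(x <- s) lalg_pos x =
  \sum_(x <- [seq x <- s | x != b]) lalg_pos x + lalg_pos b *+ count_mem b s.
Proof.
elim: s => [|a s ih]; first by rewrite !big_nil addr0.
rewrite big_cons ih /=; case: eqVneq => [->|ab] /=.
  by rewrite add1n mulrS addrCA.
by rewrite big_cons addrA.
Qed.

(** Zorn's lemma yields a maximal [Y] with [X] union [Y] consistent. The elements below finite sums
    of positive parts from this union form a cone [N] to which [point_of_maximal_cone] applies. *)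
Lemma point_le0_exists X :
  (forall s, (forall x, x \in s -> X x) -> ~ (1 : A) <= \sum_(x <- s) lalg_pos x) ->
  exists y : point A, forall x, X x -> y x <= 0.
Proof.
move=> Xc; have [|Y [Yc Ymax]] := @Zorn_bigcup A (fun Y => consistent (X `|` Y)).
  move=> F Fc totF s /(chain_seq totF)[/Xc//|[Y /Fc]]; exact.
pose N : set A := [set a | exists2 s, (forall x, x \in s -> (X `|` Y) x) &
  a <= \sum_(x <- s) lalg_pos x].
have N_in x : (X `|` Y) x -> N x.
  move=> XYx; exists [:: x] => [z|]; first by rewrite inE => /eqP->.
  by rewrite big_seq1 lalg_le_pos.
have [y yN] : exists y : point A, forall x, N x -> y x <= 0.
  apply: point_of_maximal_cone.
  - by exists nil => //; rewrite big_nil.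
  - by move=> a b ab [s sX bs]; exists s => //; exact: le_trans bs.
  - move=> a b [s sX sa] [t tX tb]; exists (s ++ t).
      by move=> x; rewrite mem_cat => /orP[/sX|/tX].
    by rewrite big_cat lalg_lerD.
  - by move=> a [s sX sa]; exists s => //; rewrite lalg_pos_le sa lalg_sum_pos_ge0.
  - by move=> [s /Yc].
  (* If no [1 - n b^+] were in [N], then [b] could be added to [Y]: in a sum reaching [1], the
     occurrences of [b] split off as [count_mem b s] copies of [b^+]. *)
  - move=> b Nb; apply: contrapT => /forallNP Nn.
    apply: (Ymax (Y `|` [set b])).
      split=> [|/(_ b (or_intror erefl)) Yb]; first by move=> x; left.
      by apply: Nb; apply: N_in; right.
    move=> s sX s1; apply: (Nn (count_mem b s)).
    exists [seq x <- s | x != b].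
      move=> x; rewrite mem_filter => /andP[/eqP xb /sX[|[|//]]]; by [left|right].
    by rewrite -(lalg_lerD2r (lalg_pos b *+ count_mem b s)) subrK -sum_pos_filter.
by exists y => x Xx; apply: yN; apply: N_in; left.
Qed.

(** Compactness of the space of points, for a cover by the sets where elements of [X] are positive;
    [point_cover_seq] reads the finite subcover back at a point. *)
Lemma point_cover X : (forall y : point A, exists2 x, X x & 0 < y x) ->
  exists2 s, (forall x, x \in s -> X x) & (1 : A) <= \sum_(x <- s) lalg_pos x.
Proof.
move=> Xy; apply: contrapT => /forall2NP h.
have [|y yX] := @point_le0_exists X; first by move=> s sX; have [] := h s.
by have [x /yX] := Xy y; rewrite leNgt => /negP.
Qed.

Lemma point_cover_seq s (y : point A) : (1 : A) <= \sum_(x <- s) lalg_pos x ->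
  exists2 x, x \in s & 0 < y x.
Proof.
move=> /(point_le y); rewrite point1 point_sum => h; apply: contrapT => /forall2NP s0.
move: h; rewrite big_seq big1 ?ler10// => x xs; rewrite point_pos.
by apply/max_r; rewrite leNgt; apply/negP; have [] := s0 x.
Qed.

(** With [c = a - b], every point is positive at [p = 1 - n c], so compactness gives [1 <= k p^+]
    for some [k]. Being disjoint from [p^+], the part [p^-] is then at most [0], that is,
    [n c <= 1]; as [n] is arbitrary, the archimedean property gives [c <= 0]. *)
Lemma lalg_le_point a b : (forall y : point A, y a <= y b) -> a <= b.
Proof.
move=> ab; rewrite -lalg_subr_le0; apply: (@bal_archimedean _ _ _ 1) => n.
set c := a - b; pose p := 1 - c *+ n.
have [y|s sp s1] := @point_cover [set p].
  exists p => //; rewrite pointB point1 pointMn pointB subr_gt0.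
  by rewrite (le_lt_trans _ ltr01)// mulrn_wle0// subr_le0.
have {}s1 : (1 : A) <= 0 + lalg_pos p *+ size s.
  rewrite (le_trans s1)// add0r (eq_big_seq (fun=> lalg_pos p)) => [|x /sp->//].
  by rewrite big_const_seq count_predT iter_addr_0.
have [m pm] := bal_bounded (lalg_pos (- p)).
have := lalg_disjoint_le (lalg_pos_ge0 p) (lalg_pos_ge0 (- p)) (lexx 0)
  (lalg_meet_posN p) pm s1.
by rewrite mul0rn lalg_pos_le => /andP[]; rewrite opprB lalg_subr_le0.
Qed.

Lemma lalg_eq_point a b : (forall y : point A, y a = y b) -> a = b.
Proof. by move=> ab; apply/le_anti/andP; split; apply: lalg_le_point => y; rewrite ab. Qed.

End PointExistence.

(** * Algebras of bounded functions *)

Lemma point_separates (R : realType) (A : lAlgType R) (y z : point A) (r s : R) :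
  y <> z -> exists a : A, y a = r /\ z a = s.
Proof.
move=> yz; have [c /eqP yzc] : exists c, y c <> z c.
  by apply: contrapT => /forallNP h; apply/yz/point_eq => c; exact: contrapT.
have d0 : y c - z c != 0 by rewrite subr_eq0.
(* Affine interpolation through the two distinct values of [c]. *)
exists (s *: (1 : A) + ((r - s) / (y c - z c)) *: (c - z c *: (1 : A))).
rewrite !pointD !pointZ !pointB !pointZ !point1 !mulr1 subrr mulr0 addr0.
by rewrite mulfVK// addrC subrK.
Qed.

Lemma point_abs_le (R : realType) (A : balType R) (a : A) :
  exists M : R, forall y : point A, `|y a| <= M.
Proof.
have [n an] := bal_bounded a; have [m am] := bal_bounded (- a).
exists (n%:R + m%:R) => y; rewrite ler_norml.
have := point_le y an; have := point_le y am.
rewrite pointN !pointMn point1 => h1 h2.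
have : 0 <= n%:R :> R by []; have : 0 <= m%:R :> R by [].
by move=> h3 h4; apply/andP; split; lra.
Qed.

(** The entry [x] keeps the set nonempty, as the lattice may have no greatest element. *)
Lemma seq_infimum (d : Order.disp_t) (L : latticeType d) (x : L) (s : seq L) :
  exists m, infimums [set` x :: s] m.
Proof.
elim: s => [|z s [m [m1 m2]]].
  by exists x; rewrite set_cons1 infimums1.
exists (Order.meet z m); split=> [w|w wl] /=.
  rewrite !inE => /or3P[/eqP->|/eqP->|ws]; rewrite ?leIl//.
    by rewrite (le_trans (leIr _ _))//; apply: m1; rewrite /= mem_head.
  by rewrite (le_trans (leIr _ _))//; apply: m1; rewrite /= inE ws orbT.
rewrite lexI wl/= ?inE ?eqxx ?orbT//=; apply: m2 => v /= vs; apply: wl => /=.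
by move: vs; rewrite !inE => /orP[->|->]; rewrite ?orbT.
Qed.

Lemma seq_supremum (d : Order.disp_t) (L : latticeType d) (x : L) (s : seq L) :
  exists m, supremums [set` x :: s] m.
Proof. exact: (@seq_infimum _ (L^d)%type). Qed.

(** The bound is only asserted to exist, so pointwise equal functions are equal. An empty [T] gives
    the zero algebra. *)
Record bfun (R : realType) (T : Type) := BFun {
  bfun_fun :> T -> R;
  bfunP : exists M, forall x, `|bfun_fun x| <= M
}.

HB.instance Definition _ (R : realType) (T : Type) := gen_eqMixin (bfun R T).
HB.instance Definition _ (R : realType) (T : Type) := gen_choiceMixin (bfun R T).

Section BoundedFunctions.
Variables (R : realType) (T : Type).
Implicit Types (f g h : bfun R T) (r : R) (x : T).

Lemma bfun_eq f g : f =1 g -> f = g.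
Proof.
case: f g => [f fP] [g gP] /= /funext fg; case: _ / fg in gP *.
by congr BFun; exact: Prop_irrelevance.
Qed.

Fact bfun_cst_subproof r : exists M, forall x : T, `|r| <= M.
Proof. by exists `|r|. Qed.
Definition bfun_cst r := BFun (bfun_cst_subproof r).

Fact bfun_opp_subproof f : exists M, forall x, `|- f x| <= M.
Proof. by have [M fM] := bfunP f; exists M => x; rewrite normrN. Qed.
Definition bfun_opp f := BFun (bfun_opp_subproof f).

Fact bfun_add_subproof f g : exists M, forall x, `|f x + g x| <= M.
Proof.
have [M fM] := bfunP f; have [N gN] := bfunP g; exists (M + N) => x.
by rewrite (le_trans (ler_normD _ _))// lerD.
Qed.
Definition bfun_add f g := BFun (bfun_add_subproof f g).

Fact bfun_mul_subproof f g : exists M, forall x, `|f x * g x| <= M.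
Proof.
have [M fM] := bfunP f; have [N gN] := bfunP g; exists (M * N) => x.
by rewrite normrM ler_pM.
Qed.
Definition bfun_mul f g := BFun (bfun_mul_subproof f g).

Definition bfun_scale r f := bfun_mul (bfun_cst r) f.

Fact bfun_min_subproof f g : exists M, forall x, `|Num.min (f x) (g x)| <= M.
Proof.
have [M fM] := bfunP f; have [N gN] := bfunP g; exists (Num.max M N) => x.
by rewrite le_max minEle; case: ifP; rewrite ?fM ?gN ?orbT.
Qed.
Definition bfun_min f g := BFun (bfun_min_subproof f g).

Fact bfun_max_subproof f g : exists M, forall x, `|Num.max (f x) (g x)| <= M.
Proof.
have [M fM] := bfunP f; have [N gN] := bfunP g; exists (Num.max M N) => x.
by rewrite le_max maxEle; case: ifP; rewrite ?fM ?gN ?orbT.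
Qed.
Definition bfun_max f g := BFun (bfun_max_subproof f g).

Definition bfun_le f g := `[< forall x, f x <= g x >].

Fact bfun_addA : associative bfun_add.
Proof. by move=> f g h; apply: bfun_eq => x; exact: addrA. Qed.
Fact bfun_addC : commutative bfun_add.
Proof. by move=> f g; apply: bfun_eq => x; exact: addrC. Qed.
Fact bfun_add0 : left_id (bfun_cst 0) bfun_add.
Proof. by move=> f; apply: bfun_eq => x; exact: add0r. Qed.
Fact bfun_addN : left_inverse (bfun_cst 0) bfun_opp bfun_add.
Proof. by move=> f; apply: bfun_eq => x; exact: addNr. Qed.

HB.instance Definition _ :=
  GRing.isZmodule.Build (bfun R T) bfun_addA bfun_addC bfun_add0 bfun_addN.

Fact bfun_mulA : associative bfun_mul.
Proof. by move=> f g h; apply: bfun_eq => x; exact: mulrA. Qed.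
Fact bfun_mul1 : left_id (bfun_cst 1) bfun_mul.
Proof. by move=> f; apply: bfun_eq => x; exact: mul1r. Qed.
Fact bfun_mulr1 : right_id (bfun_cst 1) bfun_mul.
Proof. by move=> f; apply: bfun_eq => x; exact: mulr1. Qed.
Fact bfun_mulDl : left_distributive bfun_mul bfun_add.
Proof. by move=> f g h; apply: bfun_eq => x; exact: mulrDl. Qed.
Fact bfun_mulDr : right_distributive bfun_mul bfun_add.
Proof. by move=> f g h; apply: bfun_eq => x; exact: mulrDr. Qed.

HB.instance Definition _ := GRing.Zmodule_isPzRing.Build (bfun R T)
  bfun_mulA bfun_mul1 bfun_mulr1 bfun_mulDl bfun_mulDr.

Definition bfun_lalg : lAlgType R.
Proof.
apply: (@LAlgType R (bfun R T) bfun_scale _ _ _ _ _ _ bfun_le _ _ _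
  bfun_min bfun_max).
- by move=> r s f; apply: bfun_eq => x; exact: mulrA.
- by move=> f; apply: bfun_eq => x; exact: mul1r.
- by move=> r f g; apply: bfun_eq => x; exact: mulrDr.
- by move=> f r s; apply: bfun_eq => x; exact: mulrDl.
- by move=> r f g; apply: bfun_eq => x; exact: mulrA.
- by move=> r f g; apply: bfun_eq => x; exact: mulrCA.
- by move=> f; apply/asboolP.
- move=> f g /andP[/asboolP fg /asboolP gf]; apply: bfun_eq => x.
  by apply/le_anti; rewrite fg gf.
- move=> g f h /asboolP fg /asboolP gh; apply/asboolP => x.
  exact: le_trans (fg x) (gh x).
- move=> f g h; apply/asboolP/andP => [fgh|[/asboolP fg /asboolP fh] x].
    by split; apply/asboolP => x; have := fgh x; rewrite le_min => /andP[].
  by rewrite le_min fg fh.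
- move=> f g h; apply/asboolP/andP => [fgh|[/asboolP fg /asboolP fh] x].
    by split; apply/asboolP => x; have := fgh x; rewrite ge_max => /andP[].
  by rewrite ge_max fg fh.
- by move=> h f g /asboolP fg; apply/asboolP => x; rewrite lerD2r.
- move=> f g /asboolP f0 /asboolP g0; apply/asboolP => x.
  exact: (mulr_ge0 (f0 x) (g0 x)).
- by move=> r f r0 /asboolP f0; apply/asboolP => x; exact: (mulr_ge0 r0 (f0 x)).
Defined.

End BoundedFunctions.

(** * Bounded functions form a basic algebra *)

Section BoundedFunctionsTheory.
Variables (R : realType) (T : Type).
Local Notation B := (bfun_lalg R T).
Implicit Types (f g h : B) (r : R) (x : T) (S : set B).

Definition bfun_at (f : B) (x : T) : R := bfun_fun (f : bfun R T) x.

Lemma bfun_leP f g : reflect (forall x, bfun_at f x <= bfun_at g x) (f <= g).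
Proof. exact: asboolP. Qed.

Lemma bfun_atP f g : (forall x, bfun_at f x = bfun_at g x) -> f = g.
Proof. exact: bfun_eq. Qed.

Lemma bfun_at_natr n x : bfun_at n%:R x = n%:R.
Proof. by elim: n => [|n ih]; rewrite ?mulr0n// !mulrS -ih. Qed.

Lemma bfun_at_const r x : bfun_at (lalg_const B r) x = r.
Proof. exact: mulr1. Qed.

Lemma bfun_at_mulrn f n x : bfun_at (f *+ n) x = bfun_at f x *+ n.
Proof. by elim: n => [|n ih]; rewrite ?mulr0n// !mulrS -ih. Qed.

Fact bfun_bounded : lalg_bounded B.
Proof.
move=> f; have [M fM] := bfunP (f : bfun R T).
have [n Mn] := bal_le_nat M; exists n; apply/bfun_leP => x.
by rewrite bfun_at_natr (le_trans _ Mn)// (le_trans (ler_norm _)).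
Qed.

Fact bfun_archimedean : lalg_archimedean B.
Proof.
move=> f g fg; apply/bfun_leP => x; rewrite leNgt; apply/negP => f0.
have [n gn] := bal_le_nat (bfun_at g x / bfun_at f x + 1).
have /bfun_leP/(_ x) := fg n; rewrite bfun_at_mulrn leNgt => /negP; apply.
rewrite -mulr_natl -ltr_pdivrMr//; apply: lt_le_trans gn.
by rewrite ltrDl.
Qed.

Definition bfun_bal : balType R := BalType bfun_bounded bfun_archimedean.

Let upd f x r y := if `[< y = x >] then r else bfun_at f y.

Fact bfun_upd_subproof f x r : exists M, forall y, `|upd f x r y| <= M.
Proof.
have [M fM] := bfunP (f : bfun R T); exists (Num.max `|r| M) => y.
by rewrite /upd le_max; case: ifP => _; rewrite ?lexx ?fM ?orbT.
Qed.

Definition bfun_upd f x r : B := BFun (bfun_upd_subproof f x r).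

Lemma bfun_updE f x r : bfun_at (bfun_upd f x r) x = r.
Proof. by rewrite /bfun_at /= /upd asboolT. Qed.

Lemma bfun_updNE f x r z : z <> x -> bfun_at (bfun_upd f x r) z = bfun_at f z.
Proof. by move=> zx; rewrite /bfun_at /= /upd asboolF. Qed.

(** Joins are pointwise: if [r] bounds the values at [x] of the members of [S], then [g] altered to
    [r] at [x] is still an upper bound of [S], so [g] is at most [r] at [x]. *)
Lemma bfun_sup_atP S g :
  supremums S g <-> forall x, supremums [set bfun_at f x | f in S] (bfun_at g x).
Proof.
split=> [[Sg gS] x|Sg]; last first.
  split=> [f Sf|h Sh]; apply/bfun_leP => x; have [Sgx gSx] := Sg x.
    by apply: Sgx; exists f.
  by apply: gSx => _ [f /Sh/bfun_leP fh <-].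
split=> [_ [f Sf <-]|r rS]; first exact/bfun_leP/Sg.
have /gS/bfun_leP/(_ x) : ubound S (bfun_upd g x r).
  move=> f Sf; apply/bfun_leP => y; have [->|yx] := pselect (y = x).
    by rewrite bfun_updE; apply: rS; exists f.
  by rewrite bfun_updNE//; move: y {yx}; apply/bfun_leP/Sg.
by rewrite bfun_updE.
Qed.

Lemma bfun_inf_atP S g :
  infimums S g <-> forall x, infimums [set bfun_at f x | f in S] (bfun_at g x).
Proof.
split=> [[Sg gS] x|Sg]; last first.
  split=> [f Sf|h Sh]; apply/bfun_leP => x; have [Sgx gSx] := Sg x.
    by apply: Sgx; exists f.
  by apply: gSx => _ [f /Sh/bfun_leP fh <-].
split=> [_ [f Sf <-]|r rS]; first exact/bfun_leP/Sg.
have /gS/bfun_leP/(_ x) : lbound S (bfun_upd g x r).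
  move=> f Sf; apply/bfun_leP => y; have [->|yx] := pselect (y = x).
    by rewrite bfun_updE; apply: rS; exists f.
  by rewrite bfun_updNE//; move: y {yx}; apply/bfun_leP/Sg.
by rewrite bfun_updE.
Qed.

Lemma bfun_dedekind_complete : dedekind_complete B.
Proof.
move=> S [f0 Sf0] [u uS].
pose E x := [set bfun_at f x | f in S].
have supE x : has_sup (E x).
  split; first by exists (bfun_at f0 x), f0.
  by exists (bfun_at u x) => _ [f Sf <-]; apply/bfun_leP/uS.
(* The pointwise supremum is squeezed between a member [f0] of [S] and an upper bound [u], both
   bounded functions. *)
have gM : exists M, forall x, `|sup (E x)| <= M.
  have [M fM] := bfunP (f0 : bfun R T); have [K uK] := bfunP (u : bfun R T).
  exists (Num.max M K) => x.
  have fs : bfun_at f0 x <= sup (E x) by apply: ub_le_sup; [case: (supE x)|exists f0].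
  have su : sup (E x) <= bfun_at u x.
    apply: ge_sup; first by case: (supE x).
    by move=> _ [f Sf <-]; apply/bfun_leP/uS.
  move: (fM x) (uK x); rewrite !ler_norml -/(bfun_at f0 x) -/(bfun_at u x).
  have h1 : M <= Num.max M K by rewrite le_max lexx.
  have h2 : K <= Num.max M K by rewrite le_max lexx orbT.
  move: (Num.max M K) h1 h2 => W h1 h2 /andP[h3 h4] /andP[h5 h6].
  by apply/andP; split; lra.
exists (BFun gM : B); apply/bfun_sup_atP => x; split => [r Er|r rE].
  by apply: ub_le_sup => //; case: (supE x).
by apply: ge_sup => //; case: (supE x).
Qed.

Lemma bfun_idempotents_atomic : idempotents_atomic B.
Proof.
have idem01 f x : is_idempotent f -> bfun_at f x = 0 \/ bfun_at f x = 1.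
  move=> /(congr1 (bfun_at^~ x)) h.
  have {}h : bfun_at f x * bfun_at f x = bfun_at f x by [].
  have /eqP : bfun_at f x * (bfun_at f x - 1) = 0 by rewrite mulrBr mulr1 h subrr.
  by rewrite mulf_eq0 subr_eq0 => /orP[]/eqP; [left|right].
move=> f fi f0.
have [x fx] : exists x, bfun_at f x <> 0.
  by apply: contrapT => /forallNP h; apply/f0/bfun_atP => x; exact: contrapT.
have fx1 : bfun_at f x = 1 by have [] := idem01 f x fi.
have M0 : forall y, bfun_at (0 : B) y = 0 by [].
have MM (a b : B) y : bfun_at (a * b) y = bfun_at a y * bfun_at b y by [].
(* Idempotents take only the values [0] and [1]; the atoms are the indicators of single points. *)
pose a := bfun_upd 0 x 1.
exists a; last first.
  apply: bfun_atP => y; rewrite MM; have [->|yx] := pselect (y = x).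
    by rewrite bfun_updE fx1 mulr1.
  by rewrite bfun_updNE// M0 mul0r.
split.
- apply: bfun_atP => y; rewrite MM; have [->|yx] := pselect (y = x).
    by rewrite bfun_updE mulr1.
  by rewrite bfun_updNE// M0 mul0r.
- by move=> /(congr1 (bfun_at^~ x)); rewrite bfun_updE M0 => /eqP; rewrite oner_eq0.
- move=> e ei ea; have e0 y : y <> x -> bfun_at e y = 0.
    by move=> yx; rewrite -ea MM bfun_updNE// M0 mulr0.
  have [ex|ex] := idem01 e x ei; [left|right]; apply: bfun_atP => y.
    by rewrite M0; have [->//|/e0] := pselect (y = x).
  have [->|yx] := pselect (y = x); first by rewrite bfun_updE.
  by rewrite bfun_updNE// e0.
Qed.

Lemma bfun_basic : basic_algebra bfun_bal.
Proof. by split; [exact: bfun_dedekind_complete|exact: bfun_idempotents_atomic]. Qed.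

End BoundedFunctionsTheory.

Definition bfun_point (R : realType) (T : Type) (x : T) : point (bfun_bal R T) :=
  @Point R (bfun_bal R T) (fun f => bfun_at f x) erefl (fun _ _ => erefl) (fun _ _ => erefl)
    (fun _ _ => erefl) (fun _ _ => erefl).

Section PointComp.
Variables (R : realType) (A B : lAlgType R) (y : point B) (f : lalg_hom A B).

Fact point_comp1 : y (f 1) = 1.
Proof. by have [-> _ _ _ _] := lalg_homP f; exact: point1. Qed.
Fact point_compD : {morph y \o f : a b / a + b}.
Proof. by move=> a b /=; have [_ -> _ _ _] := lalg_homP f; exact: pointD. Qed.
Fact point_compM : {morph y \o f : a b / a * b}.
Proof. by move=> a b /=; have [_ _ -> _ _] := lalg_homP f; exact: pointM. Qed.
Fact point_compZ r a : y (f (r *: a)) = r * y (f a).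
Proof. by have [_ _ _ -> _] := lalg_homP f; exact: pointZ. Qed.
Fact point_compU : {morph y \o f : a b / Order.join a b >-> Num.max a b}.
Proof. by move=> a b /=; have [_ _ _ _ [_ ->]] := lalg_homP f; exact: pointU. Qed.

Definition point_comp : point A :=
  Point point_comp1 point_compD point_compM point_compZ point_compU.

End PointComp.

Section Evaluation.
Variables (R : realType) (A : balType R) (T : Type) (phi : T -> point A).

Fact eval_subproof a : exists M, forall x, `|phi x a| <= M.
Proof. by have [M aM] := point_abs_le a; exists M. Qed.

Fact eval_is_hom :
  @is_lalg_hom R A (bfun_bal R T) (fun a => BFun (eval_subproof a)).
Proof.
split; [|move=> a b|move=> a b|move=> r a|split=> a b]; apply: bfun_atP => x.
- exact: point1.
- exact: pointD.
- exact: pointM.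
- exact: pointZ.
- exact: pointI.
- exact: pointU.
Qed.

Definition eval_hom : lalg_hom A (bfun_bal R T) := LAlgHom eval_is_hom.

End Evaluation.

(** * The evaluation embedding is a compact basic extension *)

Section Gelfand.
Variables (R : realType) (A : balType R).
Local Notation B := (bfun_bal R (point A)).
Implicit Types (a : A) (y : point A).

Definition gelfand : lalg_hom A B := eval_hom id.

Lemma gelfandE a y : bfun_at (gelfand a) y = y a. Proof. by []. Qed.

Lemma gelfand_inj : injective gelfand.
Proof.
move=> a b ab; apply: lalg_eq_point => y.
by rewrite -[LHS]gelfandE ab.
Qed.

Lemma gelfand_mono : @monomorphism (bal R) A B gelfand.
Proof.
move=> C g h gh; apply/lalg_hom_eq/funext => c; apply: gelfand_inj.
exact: (congr1 (fun k : lalg_hom C B => k c) gh).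
Qed.

(* The function equal to [b y] at [y] and to [- K] elsewhere is the meet of the
   elements of [A] above it, because [A] separates points and contains the
   constants. *)
Lemma gelfand_dense : join_meet_dense gelfand.
Proof.
move=> b; have [K bK] := bfunP (b : bfun R (point A)).
exists [set m : B | (exists S : set A, infimums (gelfand @` S) m) /\ m <= b].
  by move=> m [].
split=> [m []//|u ub]; apply/bfun_leP => y.
have by_K : - K <= bfun_at b y.
  by have := bK y; rewrite ler_norml => /andP[].
pose m : B := bfun_upd (lalg_const B (- K)) y (bfun_at b y).
have my : bfun_at m y = bfun_at b y by rewrite bfun_updE.
have mz z : z <> y -> bfun_at m z = - K.
  by move=> zy; rewrite bfun_updNE// bfun_at_const.
rewrite -my; apply/bfun_leP/ub; split; last first.
  apply/bfun_leP => z; have [->|zy] := pselect (z = y); first by rewrite my.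
  by rewrite mz//; have := bK z; rewrite ler_norml => /andP[].
exists [set a | m <= gelfand a].
split=> [_ [a ma <-]//|l lS]; apply/bfun_leP => z.
have lz a : m <= gelfand a -> bfun_at l z <= z a.
  by move=> ma; rewrite -gelfandE; apply/bfun_leP/lS; exists a.
have [zy|zy] := pselect (z = y).
  rewrite {z}zy in lz *; rewrite my -[leRHS](point_const y); apply: lz; apply/bfun_leP => w.
  rewrite gelfandE point_const.
  by have [->|wy] := pselect (w = y); rewrite ?my ?mz.
rewrite mz//; have [a [za ya]] := point_separates (- K) (bfun_at b y) zy.
(* Joining with [- K] lifts [a] above [m] everywhere without changing its value [- K] at [z]. *)
have := lz (Order.join a (- K *: (1 : A))).
rewrite pointU point_const za maxxx; apply; apply/bfun_leP => w.
rewrite gelfandE pointU point_const le_max.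
by have [->|wy] := pselect (w = y); rewrite ?my ?ya ?mz ?lexx ?orbT.
Qed.

(** At each point some difference [t - s] is positive; otherwise the join of [T] would be at most
    the meet of [S] there, against the gap [e]. By compactness finitely many differences suffice,
    and their terms form [S'] and [T']: at every point one of the chosen [t] exceeds its [s]. *)
Lemma gelfand_condition_C : condition_C gelfand.
Proof.
move=> S T e m j e0 /bfun_inf_atP Sm /bfun_sup_atP Tj mj.
pose X := [set p : A | exists st, [/\ S st.1, T st.2 & p = st.2 - st.1]].
have [y|L LX L1] := @point_cover _ A X.
  apply: contrapT => /forall2NP XN.
  have ts s t : S s -> T t -> y t <= y s.
    move=> Ss Tt; rewrite -subr_le0 -pointB leNgt; apply/negP => ts0.
    by have [] := XN (t - s); [case; exists (s, t)|].
  have jm : bfun_at j y <= bfun_at m y.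
    apply: (Tj y).2 => _ [_ [t Tt <-] <-].
    by apply: (Sm y).2 => _ [_ [s Ss <-] <-]; exact: ts.
  have /bfun_leP/(_ y) := mj.
  have -> : bfun_at (m + lalg_const B e) y = bfun_at m y + e.
    by rewrite -[e in RHS](bfun_at_const e y).
  lra.
(* Pairs are chosen for the members of [L]; [(0, 0)] is a default value elsewhere. *)
have /choice[w wP] : forall p, exists st : A * A,
    p \in L -> [/\ S st.1, T st.2 & p = st.2 - st.1].
  move=> p; have [/LX[st stP]|pL] := boolP (p \in L); first by exists st.
  by exists (0, 0).
pose S' := [set` [seq (w p).1 | p <- L]]; pose T' := [set` [seq (w p).2 | p <- L]].
have S'S : S' `<=` S by move=> _ /mapP[p /wP[? ? ?] ->].
have T'T : T' `<=` T by move=> _ /mapP[p /wP[? ? ?] ->].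
have [[a aS'] [b bT']] : (exists a, infimums S' a) /\ (exists b, supremums T' b).
  (* An empty [L] means [1 <= 0]: there are no points, any two elements of [A] are comparable both
     ways, and [0] is the meet and the join of the empty set. *)
  rewrite /S' /T'; case: L L1 {LX wP S'S T'T S' T'} => [|p L _]; last first.
    by split; [exact: seq_infimum|exact: seq_supremum].
  move=> L1; have A0 (a b : A) : a <= b.
    by apply: lalg_le_point => y; have [] := point_cover_seq y L1.
  by split; exists 0; split => ? ?; exact: A0.
exists S', T', a, b; split=> //; try by split=> //; exact: finite_seq.
apply: lalg_le_point => y.
have [p pL] := point_cover_seq y L1; have [_ _ {1}->] := wP p pL.
rewrite pointB subr_gt0 => /ltW wp.
apply: (le_trans (point_le y (_ : a <= (w p).1))).
  by apply: aS'.1; exact: map_f.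
by apply: (le_trans wp); apply: point_le; apply: bT'.1; exact: map_f.
Qed.

End Gelfand.

(** * Points of a compact basic extension *)

Section HomTheory.
Variables (R : realType) (A B : lAlgType R) (f : lalg_hom A B).

Lemma lalg_homZ r a : f (r *: a) = r *: f a.
Proof. by have [_ _ _ fZ _] := lalg_homP f. Qed.

Lemma lalg_hom_const r : f (r *: (1 : A)) = r *: (1 : B).
Proof. by rewrite lalg_homZ; have [-> _ _ _ _] := lalg_homP f. Qed.

Lemma lalg_homD a b : f (a + b) = f a + f b.
Proof. by have [_ fD _ _ _] := lalg_homP f. Qed.

Lemma lalg_homN a : f (- a) = - f a.
Proof. by rewrite -scaleN1r lalg_homZ scaleN1r. Qed.

Lemma lalg_hom_le a b : a <= b -> f a <= f b.
Proof.
have [_ _ _ _ [fI _]] := lalg_homP f.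
by move=> /meet_l ab; rewrite -ab fI leIr.
Qed.

End HomTheory.

Section Bounds.
Variables (R : realType) (A : lAlgType R).
Implicit Types (S : set A) (a b m e z : A).

Lemma infimums_opp S m : infimums S m <-> supremums (-%R @` S) (- m).
Proof.
split=> [[Sm mS]|[Sm mS]]; split.
- by move=> _ [s /Sm ms <-]; rewrite lalg_lerN2.
- move=> u uS; rewrite -[u]opprK lalg_lerN2; apply: mS => s Ss.
  by rewrite -lalg_lerN2 opprK; apply: uS; exists s.
- by move=> s Ss; rewrite -lalg_lerN2; apply: Sm; exists s.
- move=> u uS; rewrite -lalg_lerN2; apply: mS => _ [s Ss <-].
  by rewrite lalg_lerN2; exact: uS.
Qed.

Lemma dedekind_complete_inf S : dedekind_complete A ->
  S !=set0 -> has_lbound S -> exists m, infimums S m.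
Proof.
move=> Ac [s0 Ss0] [l lS]; have [||b bS] := Ac (-%R @` S).
- by exists (- s0), s0.
- by exists (- l) => _ [s Ss <-]; rewrite lalg_lerN2; exact: lS.
by exists (- b); apply/infimums_opp; rewrite opprK.
Qed.

(* If [z <= s e] for every [s] in [S], then [z + m (1 - e) <= s e + s (1 - e) = s],
   so that [z + m (1 - e) <= m]. *)
Lemma infimums_mulr S m e z : 0 <= e -> e <= 1 -> infimums S m ->
  (forall s, S s -> z <= s * e) -> z <= m * e.
Proof.
move=> e0 e1 [Sm mS] zS.
have : z + m * (1 - e) <= m.
  apply: mS => s Ss; have -> : s = s * e + s * (1 - e).
    by rewrite -mulrDr addrC subrK mulr1.
  by rewrite lalg_lerD ?zS ?lalg_ler_wpM2r ?lalg_subr_ge0 ?Sm.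
by rewrite mulrBr mulr1 addrCA -[leRHS]addr0 lalg_lerD2l lalg_subr_le0.
Qed.

Lemma supremums_mulr S m e z : 0 <= e -> e <= 1 -> supremums S m ->
  (forall s, S s -> s * e <= z) -> m * e <= z.
Proof.
move=> e0 e1 Sm zS; rewrite -lalg_lerN2 -mulNr.
apply: (@infimums_mulr (-%R @` S)) => //.
  apply/infimums_opp; rewrite opprK image_comp.
  by rewrite (_ : _ @` S = S)// -[RHS]image_id; apply: eq_imagel => x _ /=; rewrite opprK.
by move=> _ [s Ss <-]; rewrite mulNr lalg_lerN2 zS.
Qed.

Lemma supremums_join a b : supremums [set a; b] (Order.join a b).
Proof.
split; first by move=> _ [->|->]; rewrite ?leUl ?leUr.
by move=> u uab; rewrite leUx; apply/andP; split; apply: uab; [left|right].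
Qed.

End Bounds.

Lemma bal_le_approx (R : realType) (A : balType R) (a b : A) :
  (forall e : R, 0 < e -> a <= b + e *: (1 : A)) -> a <= b.
Proof.
move=> h; apply: lalg_le_point => y; apply/ler_addgt0Pr => e /h /(point_le y).
by rewrite pointD point_const.
Qed.

Lemma ler_mul_max1B (R : realType) (t : R) : 0 <= t -> t * Num.max (1 - t) 0 <= 1.
Proof.
by move=> t0; rewrite maxEle; case: (leP (1 - t) 0) => h; rewrite ?mulr0//; nra.
Qed.

(** * Atoms, extension of points and representation of the codomain *)

Section CompactExtension.
Variables (R : realType) (A B : balType R) (f : lalg_hom A B).
Hypothesis Bc : dedekind_complete B.
Hypothesis fd : join_meet_dense f.
Hypothesis fC : condition_C f.
Implicit Types (a : A) (b m : B) (y z : point A) (r : R).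

Let U y := [set a | 0 <= a /\ 1 <= y a].

Let e_ex y : exists m : B, infimums (f @` U y) m.
Proof.
apply: dedekind_complete_inf => //.
  by exists (f 1), 1 => //; split; [exact: bal_le01|rewrite point1].
exists 0 => _ [a [a0 _] <-]; rewrite -(scale0r (1 : B)) -(lalg_hom_const f).
by apply: lalg_hom_le; rewrite scale0r.
Qed.

Definition point_atom : point A -> B := projT1 (choice e_ex).
Local Notation e := point_atom.

Let eP y : infimums (f @` U y) (e y).
Proof. exact: projT2 (choice e_ex) y. Qed.

Let f1 : f 1 = 1. Proof. by have [] := lalg_homP f. Qed.
Let fM a a' : f (a * a') = f a * f a'. Proof. by have [] := lalg_homP f. Qed.
Let f0 : f 0 = 0.
Proof. by rewrite -(scale0r (1 : A)) lalg_hom_const scale0r. Qed.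

Let e_le y a : 0 <= a -> 1 <= y a -> e y <= f a.
Proof. by move=> a0 ya; apply: (eP y).1; exists a. Qed.

Let e_ge0 y : 0 <= e y.
Proof. by apply: (eP y).2 => _ [a [a0 _] <-]; rewrite -f0 lalg_hom_le. Qed.

Let e_le1 y : e y <= 1.
Proof. by rewrite -f1; apply: e_le; [exact: bal_le01|rewrite point1]. Qed.

(* Otherwise (C), applied to the meet [e y] and the constant [1/2], would give
   an element [a <= 1/2] of [A] with [y a >= 1]. *)
Let e_nle0 y : ~ e y <= 0.
Proof.
move=> e0; pose h : R := 2^-1.
have h0 : 0 < h by rewrite invr_gt0 ltr0n.
have fh : supremums (f @` [set h *: (1 : A)]) (h *: (1 : B)).
  by rewrite image_set1 lalg_hom_const supremums1.
have [|S' [T' [a [b [[/finite_seqP[s ->] S'U] [_ T'h] aS' bT' ab]]]]] :=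
  fC h0 (eP y) fh.
  by rewrite -[leRHS]add0r lalg_lerD2r.
(* Some lower bound with value at least [1] is enough, as [a] is the greatest one; starting from [1]
   also handles an empty [s]. *)
have [m mS' ym] : exists2 m : A, lbound [set` s] m & 1 <= y m.
  elim: s S'U {aS'} => [|x s ih] sU; first by exists 1; rewrite ?point1.
  have [u us|m ms ym] := ih; first by apply: sU; rewrite /= inE us orbT.
  have [_ yx] : U y x by apply: sU; rewrite /= mem_head.
  exists (Order.meet x m); last by rewrite pointI le_min yx ym.
  by move=> u /=; rewrite inE => /orP[/eqP->|us]; rewrite ?leIl// leIx2// ms ?orbT.
have ya : 1 <= y a by rewrite (le_trans ym)// point_le//; exact: aS'.2.
have yb : y b <= h.
  by rewrite -[leRHS](point_const y) point_le//; apply: bT'.2 => _ /T'h ->.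
have := le_trans ya (le_trans (point_le y ab) yb).
by rewrite leNgt invf_lt1 ?ltr0n// ltr1n.
Qed.

(** As [e y] is not below [0], the map sending [r] to [r *: e y] reflects the order; hence the
    scalar by which an element acts on [e y] is unique. *)
Let e_scale_le y r s : r *: e y <= s *: e y -> r <= s.
Proof.
rewrite leNgt => rs; apply/negP => sr; apply: (@e_nle0 y).
have d0 : 0 < r - s by rewrite subr_gt0.
have : (r - s) *: e y <= 0 by rewrite scalerBl lalg_subr_le0.
have d1 : 0 <= (r - s)^-1 by rewrite invr_ge0 ltW.
by move=> /(lalg_ler_wpZ2l d1); rewrite scalerA mulVf ?gt_eqF// scale1r scaler0.
Qed.

Let e_scale_inj y r s : r *: e y = s *: e y -> r = s.
Proof. by move=> h; apply/le_anti/andP; split; apply: (@e_scale_le y); rewrite h. Qed.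

(* [e y <= (1 - n a)^+] for every [n] as [y a = 0], and [n a (1 - n a)^+ <= 1]. *)
Let e_mul0 y a : 0 <= a -> y a = 0 -> f a * e y = 0.
Proof.
move=> a0 ya; have fa0 : 0 <= f a by rewrite -f0 lalg_hom_le.
apply/le_anti/andP; split; last by rewrite lalg_mulr_ge0.
apply: (@bal_archimedean _ _ _ 1) => n.
have ep : e y <= f (lalg_pos (1 - a *+ n)).
  apply: e_le; first exact: lalg_pos_ge0.
  by rewrite point_pos pointB point1 pointMn ya mul0rn subr0 le_max lexx.
apply: (le_trans (lalg_lerMn2r n (lalg_ler_wpM2l fa0 ep))).
rewrite -fM -scaler_nat -lalg_homZ -f1; apply: lalg_hom_le; apply: lalg_le_point => z.
rewrite pointZ pointM point_pos pointB point1 pointMn mulrA mulr_natl.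
have := point_le z a0; rewrite point0 => /(mulrn_wge0 n); move: (z a *+ n) => t t0.
exact: ler_mul_max1B.
Qed.

(** After subtracting the constant [y a], both the positive and the negative part vanish at [y], and
    [e_mul0] applies to each. *)
Let e_mulf y a : f a * e y = y a *: e y.
Proof.
apply/eqP; rewrite -subr_eq0.
have -> : f a * e y - y a *: e y = f (a - y a *: (1 : A)) * e y.
  by rewrite lalg_homD lalg_homN lalg_hom_const mulrBl lalg_scalerAl mul1r.
rewrite -(lalg_posB (a - _)) lalg_homD lalg_homN mulrBl.
rewrite !e_mul0 ?lalg_pos_ge0 ?subrr//.
  by rewrite point_pos pointN pointB point_const subrr oppr0 maxxx.
by rewrite point_pos pointB point_const subrr maxxx.
Qed.

Let K y b := exists r, b * e y = r *: e y.

(** The scalar of [m] is the infimum of the scalars of [S]. One inequality is [infimums_mulr]; for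
    the other, an element of [S] with scalar within [d] of the infimum gives an error [d *: e y], at
    most [d] because [e y <= 1]. *)
Let K_inf y (S : set B) m : infimums S m -> (forall s, S s -> K y s) -> K y m.
Proof.
move=> Sm SK; pose E := [set r | exists2 s, S s & s * e y = r *: e y].
have [n mn] := bal_bounded (- m).
have E_lb : lbound E (- n%:R).
  move=> r [s Ss sr]; apply: (@e_scale_le y); rewrite -sr.
  rewrite scaleNr scaler_nat -mulr_natl -mulNr; apply: lalg_ler_wpM2r => //.
  by rewrite (le_trans _ (Sm.1 _ Ss))// -lalg_lerN2 opprK.
(* If [S] were empty, [m] would be the greatest element of [B], forcing [1 <= 0] and hence
   [e y <= 0]. *)
have [s0 Ss0] : exists s, S s.
  apply: contrapT => /forallNP S0; apply: (@e_nle0 y).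
  apply: (le_trans (e_le1 y)); rewrite -(lalg_lerD2l m) addr0.
  by apply: Sm.2 => s /S0.
have E0 : E !=set0 by have [r rs] := SK _ Ss0; exists r, s0.
have Ei : has_inf E by split=> //; exists (- n%:R).
exists (inf E); apply/le_anti/andP; split; last first.
  apply: (infimums_mulr (e_ge0 y) (e_le1 y) Sm) => s Ss; have [r rs] := SK _ Ss.
  by rewrite rs lalg_ler_wpZ2r//; apply: ge_inf; [case: Ei|exists s].
apply: bal_le_approx => d d0; have [r [s Ss sr] rd] := inf_adherent d0 Ei.
apply: (@le_trans _ _ (s * e y)); first by rewrite lalg_ler_wpM2r ?Sm.1.
apply: (@le_trans _ _ ((inf E + d) *: e y)).
  by rewrite sr lalg_ler_wpZ2r// ltW.
by rewrite scalerDl lalg_lerD2l lalg_ler_wpZ2l// ltW.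
Qed.

Let KN y b : K y b -> K y (- b).
Proof. by move=> [r rb]; exists (- r); rewrite mulNr rb scaleNr. Qed.

Let K_all y b : K y b.
Proof.
(* Negation turns the join of [M] into a meet, so that [K_inf] serves for both layers of the density
   condition. *)
have [M Mm Mb] := fd b; rewrite -[b]opprK; apply: KN.
apply: (@K_inf y (-%R @` M)).
  apply/infimums_opp; rewrite opprK image_comp.
  by rewrite (_ : _ @` M = M)// -[RHS]image_id; apply: eq_imagel => x _ /=; rewrite opprK.
move=> _ [m /Mm[S Sm] <-]; apply: KN; apply: (K_inf Sm) => _ [a _ <-].
by exists (y a); exact: e_mulf.
Qed.

Definition point_extend_fun y : B -> R := projT1 (choice (K_all y)).
Local Notation sg := point_extend_fun.

Let sgP y b : b * e y = sg y b *: e y.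
Proof. exact: projT2 (choice (K_all y)) b. Qed.

Let sgE y b r : b * e y = r *: e y -> sg y b = r.
Proof. by rewrite sgP => /e_scale_inj. Qed.

Let sg_le y b c : b <= c -> sg y b <= sg y c.
Proof. by move=> bc; apply: (@e_scale_le y); rewrite -!sgP lalg_ler_wpM2r. Qed.

Fact point_extend1 y : sg y 1 = 1.
Proof. by apply: sgE; rewrite mul1r scale1r. Qed.

Fact point_extendD y : {morph sg y : b c / b + c}.
Proof. by move=> b c; apply: sgE; rewrite mulrDl !sgP scalerDl. Qed.

Fact point_extendM y : {morph sg y : b c / b * c}.
Proof.
by move=> b c; apply: sgE; rewrite -mulrA sgP lalg_scalerAr sgP scalerA mulrC.
Qed.

Fact point_extendZ y r b : sg y (r *: b) = r * sg y b.
Proof. by apply: sgE; rewrite lalg_scalerAl sgP scalerA. Qed.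

Fact point_extendU y : {morph sg y : b c / Order.join b c >-> Num.max b c}.
Proof.
move=> b c; apply/le_anti/andP; split; last by rewrite ge_max !sg_le ?leUl ?leUr.
apply: (@e_scale_le y); rewrite -sgP.
apply: (supremums_mulr (e_ge0 y) (e_le1 y) (supremums_join b c)).
by move=> _ [->|->]; rewrite sgP lalg_ler_wpZ2r// le_max lexx ?orbT.
Qed.

Definition point_extend y : point B :=
  Point (point_extend1 y) (point_extendD y) (point_extendM y) (point_extendZ y)
    (point_extendU y).

Lemma point_extendE y a : point_extend y (f a) = y a.
Proof. by apply: sgE; exact: e_mulf. Qed.

(** This amounts to [e y] being idempotent: [1 <= y a] gives [e y <= f a * e y], and [infimums_mulr]
    passes this to the meet. *)
Let sg_e y : sg y (e y) = 1.
Proof.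
apply/le_anti/andP; split; first by rewrite -(point_extend1 y) sg_le.
apply: (@e_scale_le y); rewrite -sgP.
apply: (infimums_mulr (e_ge0 y) (e_le1 y) (eP y)) => _ [a [a0 ya] <-].
by rewrite e_mulf lalg_ler_wpZ2r.
Qed.

(** Atoms of distinct points are orthogonal: an [a] with value [1] at [y] and [0] at [z] gives
    [e y <= f (a^+)], on which [z] vanishes. *)
Let sg_eN y z : y <> z -> sg z (e y) = 0.
Proof.
move=> yz; have [a [ya za]] := point_separates 1 0 yz.
apply/le_anti/andP; split; last by rewrite -(point0 (point_extend z)) sg_le.
have ea : e y <= f (lalg_pos a).
  by apply: e_le; rewrite ?lalg_pos_ge0// point_pos ya le_max lexx.
apply: (le_trans (sg_le z ea)).
by rewrite -[sg z _]/(point_extend z _) point_extendE point_pos za maxxx.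
Qed.

(* A meet [m] of elements of [A] on which every [sg y] is nonpositive lies below
   every [d > 0]: each [y] takes a value [< d] at one of these elements, and by
   compactness finitely many of them suffice. *)
Lemma point_extend_le0 b : (forall y, point_extend y b <= 0) -> b <= 0.
Proof.
move=> b0; have [M Mm Mb] := fd b; apply: Mb.2 => m Mm'; have [S Sm] := Mm _ Mm'.
have m0 y : sg y m <= 0 by apply: le_trans (b0 y); apply/sg_le/Mb.1.
apply: bal_le_approx => d d0; rewrite add0r; apply: lalg_le_point => z.
have [y|L LX L1] := @point_cover _ A [set d *: (1 : A) - s | s in S].
  apply: contrapT => /forall2NP XN.
  suff : d <= 0 by rewrite leNgt d0.
  apply: le_trans (m0 y); apply: (@e_scale_le y); rewrite -sgP.
  apply: (infimums_mulr (e_ge0 y) (e_le1 y) Sm) => _ [s Ss <-].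
  rewrite e_mulf lalg_ler_wpZ2r// -subr_le0 -(point_const y d) -pointB leNgt.
  by apply/negP => ds; have [] := XN (d *: (1 : A) - s); [case; exists s|].
(* Here [z] is a point of [B]; its restriction along [f] is a point of [A], at which one of the
   finitely many differences is positive. *)
have [_ /LX[s Ss <-]] := point_cover_seq (point_comp z f) L1.
rewrite pointB point_const subr_gt0 => /ltW zs; rewrite point_const.
by apply: le_trans zs; apply: point_le; apply: Sm.1; exists s.
Qed.

Lemma point_extend_le b c :
  (forall y, point_extend y b <= point_extend y c) -> b <= c.
Proof.
move=> bc; rewrite -lalg_subr_le0; apply: point_extend_le0 => y.
by rewrite pointB subr_le0.
Qed.

Definition extension_eval : lalg_hom B (bfun_bal R (point A)) :=
  eval_hom point_extend.

Lemma extension_eval_inj : injective extension_eval.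
Proof.
move=> b c bc; have yE y : point_extend y b = point_extend y c.
  exact: (congr1 (fun g => bfun_at g y) bc).
by apply/le_anti/andP; split; apply: point_extend_le => y; rewrite yE.
Qed.

(** Shifted by a bound [k], the function [g] becomes nonnegative and is realised by the join of the
    atoms weighted by its values; at [z] only [e z] contributes, by [sg_e] and [sg_eN]. *)
Lemma extension_eval_surj (g : bfun_bal R (point A)) : exists b, extension_eval b = g.
Proof.
(* A point makes the set of weighted atoms nonempty, as Dedekind completeness requires; without
   points the target is the zero algebra. *)
have [[y0 _]|A0] := pselect (exists y : point A, True); last first.
  by exists 0; apply: bfun_atP => y; case: A0; exists y.
have [k gk] := bfunP (g : bfun R (point A)).
have gk0 y : 0 <= bfun_at g y + k.
  by have := gk y; rewrite ler_norml => /andP[+ _]; rewrite -/(bfun_at g y); lra.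
have [||b bS] := Bc (S := [set (bfun_at g y + k) *: e y | y in setT]).
- by exists ((bfun_at g y0 + k) *: e y0), y0.
- exists ((k + k) *: (1 : B)) => _ [y _ <-].
  apply: (@le_trans _ _ ((bfun_at g y + k) *: (1 : B))).
    exact: lalg_ler_wpZ2l.
  apply: bal_const_le; rewrite lerD2r.
  by have := gk y; rewrite ler_norml => /andP[].
exists (b - k *: (1 : B)); apply: bfun_atP => z.
have -> : bfun_at (extension_eval (b - k *: (1 : B))) z = point_extend z b - k.
  by rewrite -[k in RHS](point_const (point_extend z)) -pointB.
suff -> : point_extend z b = bfun_at g z + k by rewrite addrK.
apply/le_anti/andP; split.
  apply: (@e_scale_le z); rewrite -sgP.
  apply: (supremums_mulr (e_ge0 z) (e_le1 z) bS) => _ [y _ <-].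
  rewrite lalg_scalerAl sgP; have [->|yz] := pselect (y = z).
    by rewrite sg_e scale1r.
  by rewrite sg_eN// scale0r scaler0 lalg_scaler_ge0.
have : sg z ((bfun_at g z + k) *: e z) <= sg z b.
  by apply: sg_le; apply: bS.1; exists z.
by rewrite point_extendZ sg_e mulr1.
Qed.

End CompactExtension.

(** * The equivalence *)

Lemma normal_hom_inf (R : realType) (A B : lAlgType R) (f : lalg_hom A B)
    (S : set A) (m : A) :
  normal_hom f -> infimums S m -> infimums (f @` S) (f m).
Proof.
move=> fN /infimums_opp/fN; rewrite lalg_homN image_comp => h; apply/infimums_opp.
rewrite image_comp; congr (supremums _ _): h.
by apply: eq_imagel => a _ /=; rewrite lalg_homN.
Qed.

(** Agreement on the image of [f] spreads first to meets, then to joins of these meets, by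
    uniqueness of greatest lower and least upper bounds. *)
Lemma normal_hom_eq (R : realType) (A B C : lAlgType R) (f : lalg_hom A B)
    (g h : lalg_hom B C) : join_meet_dense f -> normal_hom g -> normal_hom h ->
  (forall a, g (f a) = h (f a)) -> g = h.
Proof.
move=> fd gN hN gh; apply/lalg_hom_eq/funext => b; have [M Mm Mb] := fd b.
have ghM : g @` M = h @` M.
  apply: eq_imagel => m /Mm[S Sm].
  have gm := normal_hom_inf gN Sm; have hm := normal_hom_inf hN Sm.
  have ghS : g @` (f @` S) = h @` (f @` S).
    by rewrite !image_comp; apply: eq_imagel => a _ /=.
  rewrite ghS in gm; apply/le_anti/andP.
  by split; [exact: hm.2 gm.1|exact: gm.2 hm.1].
have gb := gN _ _ Mb; have hb := hN _ _ Mb; rewrite ghM in gb.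
by apply/le_anti/andP; split; [exact: gb.2 hb.1|exact: hb.2 gb.1].
Qed.

Section Bijection.
Variables (R : realType) (A B : lAlgType R) (f : lalg_hom A B).

Lemma lalg_hom_inverse : injective f -> (forall b, exists a, f a = b) ->
  exists2 g : lalg_hom B A, cancel f g & cancel g f.
Proof.
move=> fi /choice[g gK]; have [f1 fD fM fZ [fI fU]] := lalg_homP f.
have gP : is_lalg_hom g.
  by split; [|move=> a b|move=> a b|move=> r a|split=> a b]; apply: fi;
    rewrite ?(f1, fD, fM, fZ, fI, fU) !gK.
by exists (LAlgHom gP) => a //=; apply: fi; rewrite gK.
Qed.

Lemma normal_hom_bij (g : lalg_hom B A) : cancel f g -> cancel g f -> normal_hom f.
Proof.
move=> fK gK S a [Sa aS]; split; first by move=> _ [s /Sa sa <-]; exact: lalg_hom_le.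
move=> u uS; rewrite -(gK u); apply/lalg_hom_le/aS => s Ss.
by rewrite -(fK s); apply/lalg_hom_le/uS; exists s.
Qed.

End Bijection.

Section Restriction.
Variables (R : realType) (S T : Type) (phi : S -> T).

Definition bfun_restrict : lalg_hom (bfun_bal R T) (bfun_bal R S) :=
  eval_hom (@bfun_point R T \o phi).

Lemma bfun_restrictE f x : bfun_at (bfun_restrict f) x = bfun_at f (phi x).
Proof. by []. Qed.

Lemma bfun_restrict_normal : normal_hom bfun_restrict.
Proof.
move=> F g /bfun_sup_atP Fg; apply/bfun_sup_atP => x; rewrite bfun_restrictE.
by have := Fg (phi x); rewrite image_comp.
Qed.

End Restriction.

Section Equivalence.
Variable R : realType.

Definition gelfand_extension (A : balType R) : basic_extension R :=
  BasicExtension (bfun_basic R (point A)) (@gelfand_mono R A) (@gelfand_dense R A).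

Definition gelfand_ob (A : ubal R) : cbasic R :=
  exist (fun X : basic R => compact_extension X) (gelfand_extension (sval A))
    (conj (svalP A) (@gelfand_condition_C R (sval A))).

Fact gelfand_map_comm (A A' : balType R) (h : lalg_hom A A') :
  lalg_hom_comp (bfun_restrict R (fun y => point_comp y h)) (gelfand A) =
  lalg_hom_comp (gelfand A') h.
Proof. by apply/lalg_hom_eq/funext => a; apply: bfun_atP. Qed.

Definition gelfand_map (A A' : balType R) (h : lalg_hom A A') :
    basic_hom (gelfand_extension A) (gelfand_extension A') :=
  @BasicHom R (gelfand_extension A) (gelfand_extension A') h _
    (@bfun_restrict_normal R _ _ (fun y => point_comp y h)) (gelfand_map_comm h).

Definition gelfand_functor : functor (ubal R) (cbasic R).
Proof.
apply: (@Functor (ubal R) (cbasic R) gelfand_ob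
  (fun A A' h => gelfand_map (h : lalg_hom _ _))).
- move=> A; apply: basic_hom_eq => //; apply/lalg_hom_eq/funext => g.
  by apply: bfun_atP => y; congr (bfun_at g _); exact: point_eq.
- move=> A A' A'' h h'; apply: basic_hom_eq => //; apply/lalg_hom_eq/funext => g.
  by apply: bfun_atP => y; congr (bfun_at g _); exact: point_eq.
Defined.

Definition domain_functor : functor (cbasic R) (ubal R) :=
  @Functor (cbasic R) (ubal R)
    (fun X => exist (fun A : bal R => uniformly_complete (A : balType R))
       (bext_dom (sval X)) (proj1 (svalP X)))
    (fun X Y h => bhom_dom h) (fun _ => erefl) (fun _ _ _ _ _ => erefl).

(** Faithfulness of the passage to domains: equations between morphisms of basic extensions reduce
    to equations in [bal]. *)
Lemma basic_hom_ext (X Y : basic_extension R) (g h : basic_hom X Y) :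
  bhom_dom g = bhom_dom h -> g = h.
Proof.
move=> gh; apply: basic_hom_eq => //.
apply: (normal_hom_eq (@bext_dense _ X) (@bhom_normal _ _ _ g) (@bhom_normal _ _ _ h)).
move=> a; have := congr1 (fun k : lalg_hom _ _ => k a) (bhom_comm g).
by rewrite /= gh => ->; have := congr1 (fun k : lalg_hom _ _ => k a) (bhom_comm h).
Qed.

(** Extending points identifies the codomain with all bounded functions on the points of the domain.
    This identification and its inverse are normal, being order isomorphisms; that the two morphisms
    are mutually inverse then follows from [basic_hom_ext]. *)
Lemma compact_extension_iso (X : basic_extension R) : compact_extension X ->
  exists (g : basic_hom X (gelfand_extension (bext_dom X)))
         (h : basic_hom (gelfand_extension (bext_dom X)) X),
    bhom_dom g = lalg_hom_id _ /\ bhom_dom h = lalg_hom_id _.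
Proof.
move=> [_ XC]; have [Bc _] := @bext_cod_basic _ X.
pose s := extension_eval Bc (@bext_dense _ X) XC.
have sf a : s (bext_map X a) = gelfand (bext_dom X) a.
  by apply: bfun_atP => y; exact: point_extendE.
have [t sK tK] := lalg_hom_inverse (@extension_eval_inj _ _ _ _ Bc (@bext_dense _ X) XC)
  (extension_eval_surj Bc (@bext_dense _ X) XC).
have sc : lalg_hom_comp s (bext_map X) =
    lalg_hom_comp (gelfand (bext_dom X)) (lalg_hom_id _).
  by apply/lalg_hom_eq/funext => a; exact: sf.
have tc : lalg_hom_comp t (gelfand (bext_dom X)) =
    lalg_hom_comp (bext_map X) (lalg_hom_id _).
  by apply/lalg_hom_eq/funext => a; have := sK (bext_map X a); rewrite sf.
exists (@BasicHom _ X (gelfand_extension _) (lalg_hom_id _) s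
  (normal_hom_bij sK tK) sc).
by exists (@BasicHom _ (gelfand_extension _) X (lalg_hom_id _) t
  (normal_hom_bij tK sK) tc).
Qed.

End Equivalence.

Theorem theorem4p6 (R : realType) : equivalent_categories (cbasic R) (ubal R).
Proof.
exists (domain_functor R), (gelfand_functor R); split; last first.
  (* The Gelfand extension of [A] has domain [A] itself, so this isomorphism has identity
     components. *)
  exists (fun A : ubal R => lalg_hom_id _); split=> [A A' h|A].
    exact: lalg_hom_eq.
  by exists (lalg_hom_id _); split; exact: lalg_hom_eq.
have /all_sig[eta etaP] (X : cbasic R) :
    {g : basic_hom (sval X) (gelfand_extension (bext_dom (sval X))) |
      bhom_dom g = lalg_hom_id _ /\
      exists h : basic_hom (gelfand_extension (bext_dom (sval X))) (sval X),
        bhom_dom h = lalg_hom_id _}.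
  apply: cid; have [g [h [gE hE]]] := compact_extension_iso (svalP X).
  by exists g; split=> //; exists h.
exists eta; split=> [X Y h|X].
  apply: basic_hom_ext => /=; rewrite (etaP X).1 (etaP Y).1.
  exact: lalg_hom_eq.
have [gE [h hE]] := etaP X.
by exists h; split; apply: basic_hom_ext; rewrite /= gE hE; exact: lalg_hom_eq.
Qed.
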